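(* Fix an integer $n\ge 2$ and a real number $K\ne 0$. For every word $a_1a_2\cdots a_{2k}$, the associated polynomials in $\theta$ satisfy $$|a_1a_2\cdots a_{2k}\rangle=|a_{2k}a_{2k-1}\cdots a_1\rangle ,$$ i.e. reversing the order of a word does not change its polynomial.
   Context: A word is a finite sequence of letters in which each letter that appears appears exactly twice; its length is the (even) number of entries. Let $M$ be a connected, complete $n$-dimensional Riemannian manifold of constant sectional curvature $K$, with Levi-Civita connection $\nabla$. To a word $w=c_1c_2\cdots c_{2k}$ associate the tensor field $T_w=\sum_{\varphi}X_{\varphi(c_1)}\otimes X_{\varphi(c_2)}\otimes\cdots\otimes X_{\varphi(c_{2k})}$, where $X_1,\dots,X_n$ is a local orthonormal frame and $\varphi$ ranges over all maps from the set of $k$ letters of $w$ to $\{1,\dots,n\}$; $T_w$ is independent of the frame and parallel. Iterated covariant derivatives are $\nabla^1f=df$, $(\nabla^mf)(Z_1,\dots,Z_m)=(\nabla_{Z_1}(\nabla^{m-1}f))(Z_2,\dots,Z_m)$, extended linearly to $m$-tensors. If $f$ is a smooth complex-valued function on an open set with $\Delta f=-\lambda f$, $\lambda\in\mathbb{C}$ (where $\Delta f=\sum_i(\nabla^2f)(X_i,X_i)$), then $(\nabla^{2k}f)(T_w)$ is a scalar multiple of $f$, and the scalar is given by a polynomial in $\lambda$ depending only on $w$, $n$, $K$. Written as a polynomial in the variable $\theta=-\lambda$, this polynomial is denoted $|w\rangle=|c_1c_2\cdots c_{2k}\rangle$; i.e. $(\nabla^{2k}f)(T_w)=|w\rangle\big|_{\theta=-\lambda}\,f$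 for all such $f$. *)

(* Defs.v *)
Set Warnings "-notation-overridden,-ambiguous-paths,-notation-incompatible-prefix".
From mathcomp Require Import all_boot all_order all_algebra complex.
From mathcomp Require Import all_classical all_reals all_analysis.
Set Implicit Arguments.
Unset Strict Implicit.
Unset Printing Implicit Defensive.
Import Order.TTheory GRing.Theory Num.Theory numFieldNormedType.Exports.
Local Open Scope classical_set_scope.
Local Open Scope ring_scope.

(** Smooth real functions on open subsets of R^n *)

Definition pderiv (R : realType) (n : nat) (i : 'I_n)
    (h : 'rV[R]_n -> R) : 'rV[R]_n -> R :=
  fun x => 'D_(delta_mx 0 i) h x.

(* C^oo: the iterated partial derivatives of every order exist and are
   continuous.  Only used for open V. *)
Definition smooth_on (R : realType) (n : nat) (V : set 'rV[R]_n)
    (h : 'rV[R]_n -> R) : Prop :=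
  forall (s : seq 'I_n) (x : 'rV[R]_n), V x ->
    {for x, continuous (foldr (@pderiv R n) h s)} /\
    forall i : 'I_n, derivable (foldr (@pderiv R n) h s) x (delta_mx 0 i).

(** Riemannian geometry in a coordinate domain.  Tangent vectors are row
    vectors of components with respect to the coordinate frame
    d_0, ..., d_(n-1). *)

Definition inner (R : realType) (n : nat) (G : 'M[R]_n) (u v : 'rV[R]_n) : R :=
  (u *m G *m v^T) 0 0.

(* The row vectors X_a := row a E form a G-orthonormal basis. *)
Definition orthonormal_frame (R : realType) (n : nat) (G E : 'M[R]_n) : Prop :=
  E *m G *m E^T = 1%:M.

(* Levi-Civita connection: nabla_(d_i) d_j = \sum_k christoffel g x k i j d_k *)
Definition christoffel (R : realType) (n : nat) (g : 'rV[R]_n -> 'M[R]_n)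
    (x : 'rV[R]_n) (k i j : 'I_n) : R :=
  2^-1 * \sum_(l < n) invmx (g x) k l *
    (pderiv i (fun y => g y j l) x + pderiv j (fun y => g y i l) x
     - pderiv l (fun y => g y i j) x).

(* R(d_i, d_j) d_k = \sum_l curvature_coef g x i j k l d_l, where
   R(X, Y) = [nabla_X, nabla_Y] - nabla_[X, Y] *)
Definition curvature_coef (R : realType) (n : nat) (g : 'rV[R]_n -> 'M[R]_n)
    (x : 'rV[R]_n) (i j k l : 'I_n) : R :=
  pderiv i (fun y => christoffel g y l j k) x
  - pderiv j (fun y => christoffel g y l i k) x
  + \sum_(m < n) (christoffel g x l i m * christoffel g x m j k
                  - christoffel g x l j m * christoffel g x m i k).

Definition curvature (R : realType) (n : nat) (g : 'rV[R]_n -> 'M[R]_n)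
    (x u v w : 'rV[R]_n) : 'rV[R]_n :=
  \row_l \sum_(i < n) \sum_(j < n) \sum_(k < n)
    u 0 i * v 0 j * w 0 k * curvature_coef g x i j k l.

Definition sectional_curvature (R : realType) (n : nat)
    (g : 'rV[R]_n -> 'M[R]_n) (x u v : 'rV[R]_n) : R :=
  inner (g x) (curvature g x u v v) u /
  (inner (g x) u u * inner (g x) v v - inner (g x) u v ^+ 2).

(* A covariant m-tensor field is given by its components: A [:: i1; ...; im] x
   is the value of A at x on (d_i1, ..., d_im).  The rank m is not part of the
   type; the values at lists of any other size are irrelevant. *)
Definition tensor (R : realType) (n : nat) := seq 'I_n -> 'rV[R]_n -> R.

(* (nabla A)(d_i, d_j1, ..., d_jm) = (nabla_(d_i) A)(d_j1, ..., d_jm): the new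
   argument comes first. *)
Definition cov_deriv (R : realType) (n : nat) (g : 'rV[R]_n -> 'M[R]_n)
    (A : tensor R n) : tensor R n :=
  fun s x =>
    if s is i :: J then
      pderiv i (A J) x
      - \sum_(j < size J) \sum_(k < n)
          christoffel g x k i (nth i J j) * A (set_nth i J j k) x
    else 0.

Definition iter_cov_deriv (R : realType) (n : nat) (g : 'rV[R]_n -> 'M[R]_n)
    (m : nat) (h : 'rV[R]_n -> R) : tensor R n :=
  iter m (cov_deriv g) (fun _ => h).

(* A(Z_0, ..., Z_(m-1)) at the point x *)
Definition tensor_eval (R : realType) (n m : nat) (A : tensor R n)
    (x : 'rV[R]_n) (Z : 'I_m -> 'rV[R]_n) : R :=
  \sum_(I : m.-tuple 'I_n) (\prod_(j < m) Z j 0 (tnth I j)) * A I x.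

(* \sum_a (nabla^2 h)(X_a, X_a) at x, with X_a := row a E *)
Definition laplacian (R : realType) (n : nat) (g : 'rV[R]_n -> 'M[R]_n)
    (E : 'M[R]_n) (x : 'rV[R]_n) (h : 'rV[R]_n -> R) : R :=
  \sum_(a < n) tensor_eval (iter_cov_deriv g 2 h) x (fun _ : 'I_2 => row a E).

(** Words *)

Definition is_word (T : eqType) (w : seq T) : Prop :=
  forall c : T, c \in w -> count_mem c w = 2%N.

(* The j-th entry of w, as an element of the finite type of letters of w *)
Definition letter (T : eqType) (w : seq T) (j : 'I_(size w)) : seq_sub w :=
  SeqSub (mem_tnth j (in_tuple w)).

(* (nabla^(size w) h)(T_w) at x, computed with X_a := row a E; the sum ranges
   over all maps phi from the letters of w to the frame indices. *)
Definition word_deriv (R : realType) (n : nat) (g : 'rV[R]_n -> 'M[R]_n)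
    (T : choiceType) (w : seq T) (E : 'M[R]_n) (x : 'rV[R]_n)
    (h : 'rV[R]_n -> R) : R :=
  \sum_(phi : {ffun seq_sub w -> 'I_n})
    tensor_eval (iter_cov_deriv g (size w) h) x
      (fun j : 'I_(size w) => row (phi (letter j)) E).

(* Extension of a real-linear functional to complex-valued functions *)
Definition complexify (R : realType) (X : Type) (F : (X -> R) -> R)
    (f : X -> R[i]) : R[i] :=
  (F (fun x => complex.Re (f x)) +i* F (fun x => complex.Im (f x)))%C.

(** Riemannian manifolds *)

(* coord and param are inverse to each other between cdom and ccod; their
   values elsewhere are irrelevant. *)
Record chart (R : realType) (n : nat) (M : topologicalType) := Chart {
  cdom : set M;
  coord : M -> 'rV[R]_n;
  param : 'rV[R]_n -> M }.

Definition ccod (R : realType) (n : nat) (M : topologicalType)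
    (c : chart R n M) : set 'rV[R]_n := coord c @` cdom c.

Definition is_chart (R : realType) (n : nat) (M : topologicalType)
    (c : chart R n M) : Prop :=
  [/\ open (cdom c), open (ccod c),
      forall p, cdom c p -> param c (coord c p) = p,
      {within cdom c, continuous (coord c)} &
      {within ccod c, continuous (param c)}].

(* k-th component of the change of coordinates from c to d *)
Definition transition (R : realType) (n : nat) (M : topologicalType)
    (c d : chart R n M) (k : 'I_n) (x : 'rV[R]_n) : R :=
  coord d (param c x) 0 k.

(* metric c x is the Gram matrix of the coordinate frame of the chart c at the
   point of coordinates x; metric_compat is the transformation law making
   these matrices a global tensor field. *)
Record riemannian_manifold (R : realType) (n : nat) := RiemannianManifold {
  carrier :> topologicalType;
  atlas : set (chart R n carrier);
  metric : chart R n carrier -> 'rV[R]_n -> 'M[R]_n;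
  carrier_hausdorff : hausdorff_space carrier;
  carrier_second_countable : @second_countable carrier;
  atlas_chart : forall c, atlas c -> is_chart c;
  atlas_cover : forall p : carrier, exists2 c, atlas c & cdom c p;
  atlas_smooth : forall c d, atlas c -> atlas d -> forall k : 'I_n,
    smooth_on (coord c @` (cdom c `&` cdom d)) (transition c d k);
  metric_smooth : forall c, atlas c -> forall i j : 'I_n,
    smooth_on (ccod c) (fun x => metric c x i j);
  metric_sym : forall c x, atlas c -> ccod c x -> (metric c x)^T = metric c x;
  metric_pos : forall c x, atlas c -> ccod c x ->
    forall v : 'rV[R]_n, v != 0 -> 0 < inner (metric c x) v v;
  metric_compat : forall c d p, atlas c -> atlas d -> cdom c p -> cdom d p ->
    forall i j : 'I_n,
    metric c (coord c p) i j =
      \sum_(k < n) \sum_(l < n)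
        pderiv i (transition c d k) (coord c p)
        * pderiv j (transition c d l) (coord c p)
        * metric d (coord d p) k l }.

Arguments atlas {R n} _ _.

Definition constant_curvature (R : realType) (n : nat)
    (M : riemannian_manifold R n) (K : R) : Prop :=
  forall c p, atlas M c -> cdom c p ->
  forall u v : 'rV[R]_n, row_free (col_mx u v) ->
    sectional_curvature (metric c) (coord c p) u v = K.

Definition is_geodesic (R : realType) (n : nat) (M : riemannian_manifold R n)
    (gamma : R -> M) : Prop :=
  continuous gamma /\
  forall c t, atlas M c -> cdom c (gamma t) ->
    let y k : R -> R := fun s => coord c (gamma s) 0 k in
    forall k : 'I_n,
    [/\ derivable (y k) t 1, derivable (derive1 (y k)) t 1 &
        derive1 (derive1 (y k)) t
        + \sum_(i < n) \sum_(j < n)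
            christoffel (metric c) (coord c (gamma t)) k i j
            * derive1 (y i) t * derive1 (y j) t = 0].

(* Geodesic completeness *)
Definition complete_manifold (R : realType) (n : nat)
    (M : riemannian_manifold R n) : Prop :=
  forall c p (v : 'rV[R]_n), atlas M c -> cdom c p ->
  exists gamma : R -> M,
    [/\ is_geodesic gamma, gamma 0 = p &
        forall k : 'I_n, derive1 (fun s : R => coord c (gamma s) 0 k) 0 = v 0 k].

Definition smooth_function (R : realType) (n : nat)
    (M : riemannian_manifold R n) (W : set M) (f : M -> R[i]) : Prop :=
  forall c, atlas M c ->
    smooth_on (coord c @` (cdom c `&` W))
      (fun x => complex.Re (f (param c x))) /\
    smooth_on (coord c @` (cdom c `&` W))
      (fun x => complex.Im (f (param c x))).

(* Delta f = - lambda f on W *)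
Definition laplace_eigenfunction (R : realType) (n : nat)
    (M : riemannian_manifold R n) (W : set M) (lambda : R[i])
    (f : M -> R[i]) : Prop :=
  forall c p (E : 'M[R]_n), atlas M c -> cdom c p -> W p ->
    orthonormal_frame (metric c (coord c p)) E ->
    complexify (laplacian (metric c) E (coord c p)) (f \o param c)
    = - lambda * f p.

(** The polynomial of a word *)

(* (nabla^(2k) f)(T_w) = P(- lambda) f for all f with Delta f = - lambda f *)
Definition is_word_poly (R : realType) (n : nat) (K : R) (T : choiceType)
    (w : seq T) (P : {poly R[i]}) : Prop :=
  forall M : riemannian_manifold R n,
    connected [set: M] -> complete_manifold M -> constant_curvature M K ->
  forall (W : set M) (lambda : R[i]) (f : M -> R[i]),
    open W -> smooth_function W f -> laplace_eigenfunction W lambda f ->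
  forall c p (E : 'M[R]_n), atlas M c -> cdom c p -> W p ->
    orthonormal_frame (metric c (coord c p)) E ->
    complexify (word_deriv (metric c) w E (coord c p)) (f \o param c)
    = P.[- lambda] * f p.

(* |w>, in the variable theta = - lambda: the polynomial characterized by
   is_word_poly. *)
Definition word_poly (R : realType) (n : nat) (K : R) (T : choiceType)
    (w : seq T) : {poly R[i]} :=
  xget 0 [set P | is_word_poly n K w P].

(* Main.v *)
Require Import Defs.
From mathcomp Require Import all_boot all_order all_algebra.
From mathcomp Require Import all_classical all_reals all_analysis.
From mathcomp Require Import complex ring lra.
Set Implicit Arguments.
Unset Strict Implicit.
Unset Printing Implicit Defensive.
Import Order.TTheory GRing.Theory Num.Theory numFieldNormedType.Exports.
Local Open Scope ring_scope.

(** The identity already holds for [(nabla^2k f)(T_w)] itself, for every smooth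
    [f] on a space of constant curvature [K].  Let [F (i_1, ..., i_m)] be the components
    of [nabla^m f] at a point in an orthonormal frame.  As [nabla] annihilates the
    curvature tensor, the Ricci identity gives
      [F (a i j b) - F (a j i b) = K (A_ij . F (a _)) b],
    where [A_ij = e_i ^ e_j] in so(n) acts as a derivation on the entries of [b].
    For an so(n)-invariant tensor [t], put [D t = <t, F> - <t, F o rev>].
    Transposing two adjacent slots of [t] changes [D t] by [-K] times
    [<U, F> + <V, F o rev>], where [U] and [V] contract these two slots of [t]
    against [A_ij] acting on the slots to the right and to the left of them.  Both
    are invariant of degree [m - 2], so by induction the change is
    [-K <U + V, F o rev>], and [U + V = 0] by invariance of [t].  Hence [D] is
    unchanged by all transpositions of adjacent slots, therefore by reversal, so
    [D t = D (t o rev) = - D t] and [D t = 0].  Take [t] to be the tensor [T_w]. *)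

(** * The action of matrices on tensors *)

Section Action.
Variables (R : comNzRingType) (n : nat).
Implicit Types (X Y : 'M[R]_n) (t F : seq 'I_n -> R) (s a b : seq 'I_n).

(** The derivation extension of [X] to tensors: [X] is applied to one slot at a time and the results
    are added. The head index is absorbed into the function, so the rank need not appear in the type
    and a list splits cleanly into blocks of slots. *)
Fixpoint act X t s : R :=
  if s is x :: s' then
    \sum_k X x k * t (k :: s') + act X (fun u => t (x :: u)) s'
  else 0.

Lemma eq_act X t t' s :
  (forall u, size u = size s -> t u = t' u) -> act X t s = act X t' s.
Proof.
elim: s t t' => //= x s IH t t' e; congr (_ + _).
  by apply: eq_bigr => k _; rewrite e.
by apply: IH => u us; rewrite e //= us.
Qed.

Lemma act0 X s : act X (fun=> 0) s = 0.
Proof. by elim: s => //= x s ->; rewrite big1 ?addr0 // => k _; rewrite mulr0. Qed.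

Lemma actD X t t' s : act X (fun u => t u + t' u) s = act X t s + act X t' s.
Proof.
elim: s t t' => /= [|x s IH] t t'; first by rewrite addr0.
rewrite IH addrACA -big_split /=; congr (_ + _).
by apply: eq_bigr => k _; rewrite mulrDr.
Qed.

Lemma actZ X c t s : act X (fun u => c * t u) s = c * act X t s.
Proof.
elim: s t => /= [|x s IH] t; first by rewrite mulr0.
rewrite IH mulrDr mulr_sumr; congr (_ + _).
by apply: eq_bigr => k _; rewrite mulrCA.
Qed.

Lemma actN X t s : act X (fun u => - t u) s = - act X t s.
Proof.
by rewrite -mulN1r -actZ; apply: eq_act => u _; rewrite mulN1r.
Qed.

Lemma actB X t t' s : act X (fun u => t u - t' u) s = act X t s - act X t' s.
Proof. by rewrite actD actN. Qed.

Lemma act_sum X (J : finType) (t : J -> seq 'I_n -> R) s :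
  act X (fun u => \sum_j t j u) s = \sum_j act X (t j) s.
Proof.
elim: s t => /= [|x s IH] t; first by rewrite big1.
rewrite IH big_split /=; congr (_ + _); rewrite exchange_big /=.
by apply: eq_bigr => k _; rewrite mulr_sumr.
Qed.

Lemma act_mxD X Y t s : act (X + Y) t s = act X t s + act Y t s.
Proof.
elim: s t => /= [|x s IH] t; first by rewrite addr0.
rewrite IH addrACA -big_split /=; congr (_ + _).
by apply: eq_bigr => k _; rewrite mxE mulrDl.
Qed.

Lemma act_mxZ c X t s : act (c *: X) t s = c * act X t s.
Proof.
elim: s t => /= [|x s IH] t; first by rewrite mulr0.
rewrite IH mulrDr mulr_sumr; congr (_ + _).
by apply: eq_bigr => k _; rewrite mxE mulrA.
Qed.

Lemma act_mxN X t s : act (- X) t s = - act X t s.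
Proof. by rewrite -scaleN1r act_mxZ mulN1r. Qed.

Lemma act_mxB X Y t s : act (X - Y) t s = act X t s - act Y t s.
Proof. by rewrite act_mxD act_mxN. Qed.

Lemma act_mx0 t s : act 0 t s = 0.
Proof. by rewrite -(scale0r 0) act_mxZ mul0r. Qed.

Lemma act_mx_sum (J : finType) (X : J -> 'M[R]_n) t s :
  act (\sum_j X j) t s = \sum_j act (X j) t s.
Proof. by elim/big_rec2: _ => [|j y x _ <-]; rewrite ?act_mx0 ?act_mxD. Qed.

Lemma act_cat X t a b :
  act X t (a ++ b) =
  act X (fun u => t (u ++ b)) a + act X (fun u => t (a ++ u)) b.
Proof. by elim: a t => /= [|x a IH] t; rewrite ?add0r // IH addrA. Qed.

Lemma act_rev X t s : act X (fun u => t (rev u)) s = act X t (rev s).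
Proof.
elim: s t => //= x s IH t.
rewrite rev_cons -cats1 act_cat /= addr0 addrC -IH; congr (_ + _).
  by apply: eq_act => u _; rewrite rev_cons cats1.
by apply: eq_bigr => k _; rewrite rev_cons cats1.
Qed.

(** Actions on disjoint blocks of slots commute. *)
Lemma act_act X Y (t : seq 'I_n -> seq 'I_n -> R) a b :
  act X (fun u => act Y (t u) b) a = act Y (fun v => act X (t^~ v) a) b.
Proof.
elim: a t => /= [|x a IH] t; first by rewrite act0.
rewrite (IH (fun u => t (x :: u))) actD act_sum; congr (_ + _).
by apply: eq_bigr => k _; rewrite actZ.
Qed.

(** Terms in which [X] and [Y] hit different slots cancel; when both hit the same slot, the matrix
    commutator remains. The order of the product is kept because the row index of the matrix is the
    given index and its column index is summed. *)
Lemma act_comm X Y t s :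
  act X (act Y t) s - act Y (act X t) s = act (X *m Y - Y *m X) t s.
Proof.
elim: s t => /= [|x s IH] t; first by rewrite subrr.
rewrite !actD -IH !act_sum.
have E (Z W : 'M[R]_n) : \sum_k Z x k * (\sum_j W k j * t (j :: s) +
   act W (fun u => t (k :: u)) s) = \sum_j (Z *m W) x j * t (j :: s) +
   \sum_k Z x k * act W (fun u => t (k :: u)) s.
  under eq_bigr do rewrite mulrDr mulr_sumr.
  rewrite big_split /= exchange_big /=; congr (_ + _).
  apply: eq_bigr => j _; rewrite mxE mulr_suml.
  by apply: eq_bigr => k _; rewrite mulrA.
have L (Z W : 'M[R]_n) : \sum_j act Z (fun u => W x j * t (j :: u)) s =
   \sum_k W x k * act Z (fun u => t (k :: u)) s.
  by apply: eq_bigr => j _; rewrite actZ.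
rewrite !E !L.
have -> : \sum_k (X *m Y - Y *m X) x k * t (k :: s) =
  \sum_j (X *m Y) x j * t (j :: s) - \sum_j (Y *m X) x j * t (j :: s).
  by rewrite -sumrB; apply: eq_bigr => k _; rewrite !mxE mulrBl.
ring.
Qed.


(** * Sums over multi-indices and the pairing of tensors *)

Fixpoint sumseq m (G : seq 'I_n -> R) : R :=
  if m is m'.+1 then \sum_x sumseq m' (fun s => G (x :: s)) else G [::].

Lemma eq_sumseq m G G' :
  (forall s, size s = m -> G s = G' s) -> sumseq m G = sumseq m G'.
Proof.
elim: m G G' => /= [|m IH] G G' e; first exact: e.
by apply: eq_bigr => x _; apply: IH => s ss; apply: e; rewrite /= ss.
Qed.

Lemma sumseqD m G G' :
  sumseq m (fun s => G s + G' s) = sumseq m G + sumseq m G'.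
Proof.
elim: m G G' => //= m IH G G'; rewrite -big_split /=.
by apply: eq_bigr => x _.
Qed.

Lemma sumseqZ m c G : sumseq m (fun s => c * G s) = c * sumseq m G.
Proof.
by elim: m G => //= m IH G; rewrite mulr_sumr; apply: eq_bigr => x _.
Qed.

Lemma sumseqB m G G' :
  sumseq m (fun s => G s - G' s) = sumseq m G - sumseq m G'.
Proof.
rewrite -mulN1r -sumseqZ -sumseqD; apply: eq_sumseq => s _.
by rewrite mulN1r.
Qed.

Lemma sumseq0 m : sumseq m (fun=> 0) = 0.
Proof. by elim: m => //= m ->; rewrite big1. Qed.

Lemma sumseq_sum m (J : finType) (G : J -> seq 'I_n -> R) :
  sumseq m (fun s => \sum_j G j s) = \sum_j sumseq m (G j).
Proof.
elim: m G => //= m IH G; under eq_bigr do rewrite IH.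
by rewrite exchange_big.
Qed.

Lemma sumseq_cat p q G :
  sumseq (p + q) G = sumseq p (fun a => sumseq q (fun b => G (a ++ b))).
Proof. by elim: p G => //= p IH G; apply: eq_bigr => x _; rewrite IH. Qed.

Lemma sumseq_exchange p q (G : seq 'I_n -> seq 'I_n -> R) :
  sumseq p (fun a => sumseq q (G a)) =
  sumseq q (fun b => sumseq p (G^~ b)).
Proof.
elim: p G => //= p IH G; rewrite sumseq_sum.
by apply: eq_bigr => x _; rewrite IH.
Qed.

Lemma sumseq_rev m G : sumseq m (fun s => G (rev s)) = sumseq m G.
Proof.
elim: m G => // m IH G; rewrite -[in RHS]addn1 sumseq_cat /= sumseq_sum.
apply: eq_bigr => x _; rewrite -[in RHS]IH; apply: eq_sumseq => s _.
by rewrite rev_cons cats1.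
Qed.

(** Summation by parts: for the full contraction pairing, the adjoint of the derivation action of
    [X] is that of its transpose. *)
Lemma sumseq_parts m X t F :
  sumseq m (fun s => act X t s * F s) = sumseq m (fun s => t s * act X^T F s).
Proof.
elim: m t F => /= [|m IH] t F; first by rewrite mul0r mulr0.
under eq_bigr => x _.
  under eq_sumseq => s _ do rewrite mulrDl mulr_suml.
  rewrite sumseqD sumseq_sum IH; over.
under [RHS]eq_bigr => x _.
  under eq_sumseq => s _ do rewrite mulrDr mulr_sumr.
  rewrite sumseqD sumseq_sum; over.
rewrite !big_split /=; congr (_ + _).
rewrite exchange_big /=; apply: eq_bigr => k _; apply: eq_bigr => x _.
by apply: eq_sumseq => s _; rewrite mxE; ring.
Qed.

(** Transposes the slots [p] and [p + 1]. Lists without a slot [p + 1] are left unchanged, so that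
    [swp p] is a length-preserving involution for every [p]. *)
Fixpoint swp p s : seq 'I_n :=
  match p, s with
  | 0, i :: j :: b => j :: i :: b
  | p'.+1, x :: s' => x :: swp p' s'
  | _, _ => s
  end.

Lemma size_swp p s : size (swp p s) = size s.
Proof. by elim: p s => [|p IH] [|x s] //=; [case: s | rewrite IH]. Qed.

Lemma swpK p s : swp p (swp p s) = s.
Proof. by elim: p s => [|p IH] [|x s] //=; [case: s | rewrite IH]. Qed.

Lemma swp_cat a i j b : swp (size a) (a ++ i :: j :: b) = a ++ j :: i :: b.
Proof. by elim: a => //= x a ->. Qed.

Lemma swp_small p s : (size s < p + 2)%N -> swp p s = s.
Proof.
by elim: p s => [|p IH] [|x s] //=; [case: s | move=> h; rewrite IH].
Qed.

Lemma act_swp X p t s : act X (fun u => t (swp p u)) s = act X t (swp p s).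
Proof.
elim: p s t => [|p IH] [|x s] t //=; last by rewrite -IH.
by case: s => //= y s; rewrite addrCA.
Qed.

Lemma sumseq_swp m p G : sumseq m (fun s => G (swp p s)) = sumseq m G.
Proof.
elim: p m G => [|p IH] [|m] G //=; last first.
  by apply: eq_bigr => x _; exact: (IH m (fun s => G (x :: s))).
by case: m => //= m; rewrite exchange_big.
Qed.

Lemma foldr_swpS l x s :
  foldr swp (x :: s) (map succn l) = x :: foldr swp s l.
Proof. by elim: l => //= p l ->. Qed.

Lemma rcons_swps m :
  exists l, forall x s, size s = m -> foldr swp (x :: s) l = rcons s x.
Proof.
elim: m => [|m [l Hl]]; first by exists [::] => x [].
exists (map succn l ++ [:: 0%N]) => x [//|y s] /= [ss].
by rewrite foldr_cat /= foldr_swpS Hl.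
Qed.

(** First reverse the tail, then carry the head to the end. The list [l] of transpositions depends
    on the length only, so one list serves all multi-indices of a sum. *)
Lemma rev_swps m : exists l, forall s, size s = m -> foldr swp s l = rev s.
Proof.
elim: m => [|m [l Hl]]; first by exists [::] => -[].
have [l' Hl'] := rcons_swps m.
exists (l' ++ map succn l) => -[//|x s] /= [ss].
by rewrite foldr_cat foldr_swpS Hl // Hl' ?size_rev // rev_cons.
Qed.

(** Invariance is infinitesimal, under the Lie algebra of skew matrices, which is the form in which
    curvature acts. The length [m] plays the part of the rank. *)
Definition so_invariant m t :=
  forall X, X^T = - X -> forall s, size s = m -> act X t s = 0.

Lemma so_invariant_swp m p t :
  so_invariant m t -> so_invariant m (fun s => t (swp p s)).
Proof. by move=> ti X Xs s ss; rewrite act_swp ti ?size_swp. Qed.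

Definition so_mx (i j : 'I_n) : 'M[R]_n := delta_mx i j - delta_mx j i.

Lemma tr_so_mx i j : (so_mx i j)^T = - so_mx i j.
Proof. by rewrite /so_mx linearB /= !trmx_delta opprB. Qed.

Lemma so_mxC i j : so_mx j i = - so_mx i j.
Proof. by rewrite /so_mx opprB. Qed.

Lemma mulmx_delta_sum X (k l : 'I_n) : X *m delta_mx k l = \sum_q X q k *: delta_mx q l.
Proof.
apply/matrixP => a b; rewrite mxE summxE (bigD1 k) //= [RHS](bigD1 a) //=.
rewrite !mxE !eqxx !big1 // => q /negPf qn; rewrite !mxE.
  by rewrite eq_sym qn mulr0.
by rewrite qn mulr0.
Qed.

Lemma mul_delta_mx_sum X (k l : 'I_n) : delta_mx k l *m X = \sum_q X l q *: delta_mx k q.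
Proof.
apply: trmx_inj; rewrite trmx_mul trmx_delta mulmx_delta_sum linear_sum.
by apply: eq_bigr => q _; apply/matrixP => a b; rewrite !mxE andbC.
Qed.

(** The derivation rule on the bivector [so_mx i j]. It is stated for arbitrary [X] since it also
    serves for connection matrices in a coordinate frame, which are not skew in general. *)
Lemma so_mx_derivation X i j :
  X^T *m so_mx i j + so_mx i j *m X =
  \sum_q X i q *: so_mx q j + \sum_q X j q *: so_mx i q.
Proof.
rewrite /so_mx mulmxBr mulmxBl !mul_delta_mx_sum !mulmx_delta_sum -!sumrN -!big_split /=.
by apply: eq_bigr => q _; apply/matrixP => a b; rewrite !mxE; ring.
Qed.

Lemma so_mx_comm X i j : X^T = - X ->
  X *m so_mx i j - so_mx i j *m X =
  \sum_q X q i *: so_mx q j + \sum_q X q j *: so_mx i q.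
Proof.
move=> Xs; have Xa k l : X k l = - X l k.
  by move/matrixP: Xs => /(_ l k); rewrite !mxE.
have := so_mx_derivation X i j; rewrite Xs mulNmx => /(congr1 -%R).
rewrite opprD opprK => ->; rewrite opprD -!sumrN; congr (_ + _);
  by apply: eq_bigr => q _; rewrite -scaleNr -Xa.
Qed.

(** The tensor [U] of the overview: slots [p] and [p + 1] of [t] are contracted against [so_mx],
    acting on the slots to their right. *)
Definition contract p t s : R :=
  \sum_i \sum_j
    act (so_mx i j) (fun u => t (take p s ++ i :: j :: u)) (drop p s).

Lemma contract_cat t a b :
  contract (size a) t (a ++ b) =
  \sum_i \sum_j act (so_mx i j) (fun u => t (a ++ i :: j :: u)) b.
Proof. by rewrite /contract take_size_cat // drop_size_cat. Qed.

(** Contraction is equivariant. Moving [X] past [so_mx i j] leaves a bracket, which is [X] acting on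
    the indices [i] and [j] of [so_mx]; it cancels against the action of [X] on the two contracted
    slots of [t]. *)
Lemma contract_invariant p q t :
  so_invariant (p + q.+2) t -> so_invariant (p + q) (contract p t).
Proof.
move=> ti X Xs s ss.
have sa : size (take p s) = p by rewrite size_takel // ss leq_addr.
have sb : size (drop p s) = q by rewrite size_drop ss addKn.
rewrite -(cat_take_drop p s); move: (take p s) (drop p s) sa sb => a b sa sb.
pose T i j M := act M (fun v => t (a ++ i :: j :: v)) b.
rewrite act_cat.
have -> : act X (fun u => contract p t (u ++ b)) a = \sum_i \sum_j
   act (so_mx i j) (fun v => act X (fun u => t (u ++ i :: j :: v)) a) b.
  transitivity (act X (fun u => \sum_i \sum_j
     act (so_mx i j) (fun v => t (u ++ i :: j :: v)) b) a).
    by apply: eq_act => u us; rewrite -sa -us contract_cat.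
  rewrite act_sum; apply: eq_bigr => i _; rewrite act_sum.
  by apply: eq_bigr => j _; rewrite act_act.
have -> : act X (fun u => contract p t (a ++ u)) b = \sum_i \sum_j
   (act (so_mx i j) (act X (fun v => t (a ++ i :: j :: v))) b +
    (\sum_k X k i * T i j (so_mx k j) + \sum_k X k j * T i j (so_mx i k))).
  transitivity (act X (fun v => \sum_i \sum_j
     act (so_mx i j) (fun v => t (a ++ i :: j :: v)) v) b).
    by apply: eq_act => u us; rewrite -sa contract_cat.
  rewrite act_sum; apply: eq_bigr => i _; rewrite act_sum.
  apply: eq_bigr => j _; apply/eqP; rewrite addrC -subr_eq act_comm.
  rewrite so_mx_comm // act_mxD !act_mx_sum; apply/eqP.
  by congr (_ + _); apply: eq_bigr => k _; rewrite act_mxZ.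
rewrite -big_split /=; under eq_bigr do rewrite -big_split /=.
(* Invariance of [t] turns the action of [X] on the outer slots into minus its action on the two
   inner slots. The terms are grouped by the inner slot that is hit. *)
transitivity (\sum_i \sum_j
   ((\sum_k X k i * T i j (so_mx k j) - \sum_k X i k * T k j (so_mx i j)) +
    (\sum_k X k j * T i j (so_mx i k) - \sum_k X j k * T i k (so_mx i j)))).
  apply: eq_bigr => i _; apply: eq_bigr => j _.
  rewrite addrA -actD.
  rewrite (@eq_act _ _ (fun v => - (\sum_k X i k * t (a ++ k :: j :: v) +
      \sum_k X j k * t (a ++ i :: k :: v)))); last first.
    move=> v vb; have := ti X Xs (a ++ i :: j :: v).
    rewrite size_cat /= vb sa sb act_cat /= => /(_ erefl) H.
    by apply/eqP; rewrite -addr_eq0 -addrA [X in _ + X]addrC -addrA H.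
  rewrite actN actD !act_sum.
  under [X in - (X + _)]eq_bigr do rewrite actZ.
  under [X in - (_ + X)]eq_bigr do rewrite actZ.
  rewrite /T; ring.
under eq_bigr do rewrite big_split /=.
rewrite big_split /=; apply/eqP; rewrite addr_eq0; apply/eqP.
(* In each group the two sums differ only by renaming the summation indices. *)
transitivity (0 : R); last (apply/esym/eqP; rewrite oppr_eq0; apply/eqP).
  under eq_bigr do rewrite sumrB.
  rewrite sumrB; apply/eqP; rewrite subr_eq0; apply/eqP.
  under eq_bigr do rewrite exchange_big /=.
  rewrite exchange_big /=.
  by apply: eq_bigr => i _; rewrite exchange_big.
apply: big1 => i _; rewrite sumrB; apply/eqP; rewrite subr_eq0; apply/eqP.
by rewrite exchange_big.
Qed.

End Action.

(** * Invariant tensors pair equally with [F] and with its reversal *)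

Section Reversal.
Variables (R : numDomainType) (n : nat) (c : R) (F : seq 'I_n -> R).
Hypothesis Fswp : forall a i j b, F (a ++ i :: j :: b) - F (a ++ j :: i :: b) =
  c * act (so_mx R i j) (fun u => F (a ++ u)) b.

Let F' s := F (rev s).

(** Reversal exchanges the two sides of the swapped pair, so the action moves to the slots on the
    left; it also exchanges [i] and [j], whence the sign. *)
Lemma Frev_swp a i j b : F' (a ++ i :: j :: b) - F' (a ++ j :: i :: b) =
  - (c * act (so_mx R i j) (fun u => F' (u ++ b)) a).
Proof.
have E k l : rev (a ++ k :: l :: b) = rev b ++ l :: k :: rev a.
  by rewrite rev_cat !rev_cons -!cats1 -!catA.
rewrite /F' !E Fswp (so_mxC _ i j) act_mxN mulrN -act_rev; congr (- (_ * _)).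
by apply: eq_act => u _; rewrite rev_cat.
Qed.

Lemma so_parts m i j (t G : seq 'I_n -> R) :
  sumseq m (fun s => t s * act (so_mx R i j) G s) =
  - sumseq m (fun s => act (so_mx R i j) t s * G s).
Proof.
rewrite sumseq_parts tr_so_mx -mulN1r -sumseqZ; apply: eq_sumseq => s _.
by rewrite act_mxN; ring.
Qed.

Lemma sumseq_swp_diff p q t : so_invariant (p + q.+2) t ->
  (forall u, so_invariant (p + q) u ->
     sumseq (p + q) (fun s => u s * F s) = sumseq (p + q) (fun s => u s * F' s)) ->
  sumseq (p + q.+2) (fun s => t s * (F s - F' s)) =
  sumseq (p + q.+2) (fun s => t (swp p s) * (F s - F' s)).
Proof.
move=> ti IH.
(* Reindexing moves the transposition from [t] to [F] and [F'], so that the commutation relations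
   apply. *)
rewrite -[RHS](sumseq_swp _ p); apply/eqP; rewrite -subr_eq0 -sumseqB.
pose G s := t s * ((F s - F (swp p s)) - (F' s - F' (swp p s))).
rewrite (@eq_sumseq _ _ _ _ G); last by move=> s _; rewrite /G swpK; ring.
rewrite sumseq_cat.
(* The mirror image of [contract], acting on the slots to the left. *)
pose V a b := \sum_i \sum_j
  act (so_mx R i j) (fun u => t (u ++ i :: j :: b)) a.
transitivity (sumseq p (fun a => sumseq q (fun b =>
   - c * (contract p t (a ++ b) * F (a ++ b) + V a b * F' (a ++ b)))) == 0).
  congr (_ == 0).
  transitivity (\sum_i \sum_j c * (
    sumseq p (fun a => sumseq q (fun b => t (a ++ i :: j :: b) *
      act (so_mx R i j) (fun u => F (a ++ u)) b)) +
    sumseq p (fun a => sumseq q (fun b => t (a ++ i :: j :: b) *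
      act (so_mx R i j) (fun u => F' (u ++ b)) a)))).
    rewrite /= sumseq_sum; apply: eq_bigr => i _.
    rewrite sumseq_sum; apply: eq_bigr => j _.
    rewrite -sumseqD -sumseqZ; apply: eq_sumseq => a sa.
    rewrite -sumseqD -sumseqZ; apply: eq_sumseq => b sb.
    by rewrite /G -{1 2}sa !swp_cat Fswp Frev_swp; ring.
  (* Summation by parts moves [so_mx i j] onto [t]; the sign comes from its skewness. *)
  transitivity (\sum_i \sum_j - c * (
    sumseq p (fun a => sumseq q (fun b =>
      act (so_mx R i j) (fun u => t (a ++ i :: j :: u)) b * F (a ++ b))) +
    sumseq p (fun a => sumseq q (fun b =>
      act (so_mx R i j) (fun u => t (u ++ i :: j :: b)) a * F' (a ++ b))))).
    apply: eq_bigr => i _; apply: eq_bigr => j _.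
    rewrite mulNr -mulrN; congr (c * _); rewrite opprD; congr (_ + _).
      rewrite -mulN1r -sumseqZ; apply: eq_sumseq => a _.
      by rewrite so_parts mulN1r.
    rewrite sumseq_exchange [X in _ = - X]sumseq_exchange.
    rewrite -mulN1r -sumseqZ; apply: eq_sumseq => b _.
    by rewrite (@so_parts p i j (fun a => t (a ++ i :: j :: b))) mulN1r.
  apply/esym.
  under eq_sumseq => a sa.
    under eq_sumseq => b sb.
      rewrite -{1}sa contract_cat !mulr_suml -big_split mulr_sumr /=.
      over.
    rewrite sumseq_sum /=.
    over.
  rewrite sumseq_sum; apply: eq_bigr => i _.
  under eq_sumseq => a sa.
    under eq_sumseq => b sb.
      rewrite !mulr_suml -big_split mulr_sumr /=.
      over.
    rewrite sumseq_sum /=.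
    over.
  rewrite sumseq_sum; apply: eq_bigr => j _.
  rewrite -sumseqD -sumseqZ; apply: eq_sumseq => a _.
  by rewrite -sumseqD -sumseqZ; apply: eq_sumseq => b _.
apply/eqP.
transitivity (- c * (sumseq (p + q) (fun s => contract p t s * F s) +
   sumseq p (fun a => sumseq q (fun b => V a b * F' (a ++ b))))).
  rewrite sumseq_cat -sumseqD -sumseqZ; apply: eq_sumseq => a _.
  by rewrite -sumseqD -sumseqZ; apply: eq_sumseq => b _.
(* The contraction is invariant with two slots fewer, so [F] may be replaced by [F'] in the first
   term. It remains to see that [contract] and [V] add up to zero. *)
rewrite IH; last exact: contract_invariant.
rewrite sumseq_cat -sumseqD.
rewrite (@eq_sumseq _ _ _ _ (fun=> 0)) ?sumseq0 ?mulr0 // => a sa.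
rewrite -sumseqD (@eq_sumseq _ _ _ _ (fun=> 0)) ?sumseq0 // => b sb.
rewrite -mulrDl -sa contract_cat /V.
rewrite [X in X * _](_ : _ = 0) ?mul0r // -big_split /=.
have slot i j : act (so_mx R i j) (fun u => t (u ++ i :: j :: b)) a +
   act (so_mx R i j) (fun v => t (a ++ i :: j :: v)) b =
   - (\sum_k so_mx R i j i k * t (a ++ k :: j :: b) +
      \sum_k so_mx R i j j k * t (a ++ i :: k :: b)).
  have := ti _ (tr_so_mx R i j) (a ++ i :: j :: b).
  rewrite size_cat /= sa sb act_cat /= => /(_ erefl) H.
  by apply/eqP; rewrite -addr_eq0 -addrA [X in _ + X]addrC -addrA H.
have E (f : 'I_n -> R) i j k :
   \sum_l so_mx R i j k l * f l = (k == i)%:R * f j - (k == j)%:R * f i.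
  have D u v : \sum_l (delta_mx u v : 'M[R]_n) k l * f l = (k == u)%:R * f v.
    rewrite (bigD1 v) //= mxE eqxx andbT big1 ?addr0 // => l /negPf lv.
    by rewrite mxE lv andbF mul0r.
  by rewrite -!D -sumrB; apply: eq_bigr => l _; rewrite !mxE mulrBl.
(* By invariance of [t] under [so_mx i j], the left and right actions together equal minus the
   action on the two inner slots. This is [g i - g j], whose double sum vanishes by antisymmetry. *)
pose g i := t (a ++ i :: i :: b).
transitivity (\sum_i \sum_j (g i - g j)).
  apply: eq_bigr => i _; rewrite -big_split; apply: eq_bigr => j _ /=.
  rewrite addrC slot (E (fun k => t (a ++ k :: j :: b))).
  rewrite (E (fun k => t (a ++ i :: k :: b))) !eqxx [j == i]eq_sym /g.
  by case: eqP => [->|_] /=; ring.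
under eq_bigr do rewrite sumrB.
by rewrite sumrB exchange_big subrr.
Qed.

Theorem sumseq_reversal m t : so_invariant m t ->
  sumseq m (fun s => t s * F s) = sumseq m (fun s => t s * F (rev s)).
Proof.
elim/ltn_ind: m t => m IH t ti.
pose D u := sumseq m (fun s => u s * (F s - F' s)).
have Dswp p u : so_invariant m u -> D u = D (fun s => u (swp p s)).
  move=> ui; have [pm|pm] := ltnP m (p + 2).
    by apply: eq_sumseq => s sm; rewrite swp_small // sm.
  pose q := (m - (p + 2))%N.
  have mE : m = (p + q.+2)%N.
    by rewrite -(subnKC pm) -/q addn2 addSnnS addSnnS.
  rewrite /D mE; apply: sumseq_swp_diff; rewrite -?mE // => v vi.
  by apply: IH; rewrite // mE ltn_add2l; apply: ltnW.
have [l lrev] := rev_swps n m.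
have Dl k u : so_invariant m u -> D u = D (fun s => u (foldr (@swp n) s k)).
  elim: k u => //= p k IHk u ui.
  by rewrite (Dswp p) // IHk //; apply: so_invariant_swp.
(* The transpositions replace [t] by its reversal; reindexing the sum by reversal then exchanges [F]
   and [F']. *)
have : D t = - D t.
  rewrite {1}(Dl l) // /D -mulN1r -sumseqZ -[LHS]sumseq_rev.
  apply: eq_sumseq => s sm; rewrite lrev ?size_rev // revK /F' revK.
  by rewrite mulN1r -mulrN opprB.
rewrite /D => /eqP; rewrite -subr_eq0 opprK -mulr2n mulrn_eq0 /= => /eqP D0.
apply/eqP; rewrite -subr_eq0 -sumseqB -[X in _ == X]D0; apply/eqP.
by apply: eq_sumseq => s _; rewrite mulrBr.
Qed.

End Reversal.

(** * The tensor of a word and its invariance *)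

Section WordTensor.
Variables (R : realType) (n : nat) (T : choiceType).
Implicit Types (w : seq T) (s : seq 'I_n).

(* [(compatible w s)%:R] is the component of [T_w] along the frame indices [s]. *)
Definition compatible w s : bool :=
  all2rel (fun u v => (u.1 == v.1) ==> (u.2 == v.2)) (zip w s).

Lemma compatibleP w s :
  reflect {in zip w s &, forall u v, u.1 = v.1 -> u.2 = v.2} (compatible w s).
Proof.
apply: (iffP allrelP) => h u v uw vw.
  by move=> /eqP e; apply/eqP; apply: implyP (h u v uw vw) e.
by apply/implyP => /eqP e; apply/eqP; apply: h.
Qed.

Lemma compatible_rev w s : size s = size w ->
  compatible (rev w) (rev s) = compatible w s.
Proof.
move=> sw; apply/compatibleP/compatibleP => h u v uw vw; apply: h;
  by move: uw vw; rewrite -rev_zip ?mem_rev.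
Qed.

(** The word tensor is a Kronecker delta in the two slots of [c], times the tensor of the word with
    [c] deleted. This is the inductive structure behind its invariance. *)
Lemma compatible_pair (c : T) (b d : seq T) x y b' d' :
  size b' = size b -> c \notin b ++ d ->
  compatible (c :: b ++ c :: d) (x :: b' ++ y :: d') =
  (x == y) && compatible (b ++ d) (b' ++ d').
Proof.
move=> sb cbd; rewrite /compatible zip_cat //.
set z := zip b b'; set z' := zip d d'.
have -> : zip (c :: b ++ c :: d) (x :: b' ++ y :: d') = (c, x) :: z ++ (c, y) :: z'.
  by rewrite /= zip_cat.
have zc u : u \in z ++ z' -> u.1 != c.
  rewrite /z /z' -zip_cat // => /(map_f fst) /= uz; apply: contraNneq cbd => <-.
  suff : {subset unzip1 (zip (b ++ d) (b' ++ d')) <= b ++ d} by apply.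
  by elim: (b ++ d) (b' ++ d') => [|k l IH] [|k' l'] //= e;
    rewrite !inE => /orP[->|/IH ->]; rewrite ?orbT.
have mz u : (u \in (c, x) :: z ++ (c, y) :: z') =
    [|| u == (c, x), u == (c, y) | u \in z ++ z'].
  by rewrite !(inE, mem_cat); congr (_ || _); rewrite orbCA.
apply/idP/idP => [/allrelP h|/andP[/eqP xy /allrelP h]]; last first.
  subst y.
  apply/allrelP => u v.
  rewrite !mz => /or3P[/eqP->|/eqP->|uz] /or3P[/eqP->|/eqP->|vz] //=.
  all: rewrite ?eqxx // 1?[c == _]eq_sym ?(negPf (zc _ uz)) ?(negPf (zc _ vz)) //.
  exact: h.
apply/andP; split.
  by apply: implyP (h (c, x) (c, y) _ _) _; rewrite ?mz ?eqxx ?orbT.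
by apply/allrelP => u v uz vz; apply: h; rewrite mz ?uz ?vz !orbT.
Qed.

Lemma is_word_pair w : is_word w -> w = [::] \/ exists c b d,
  [/\ w = c :: b ++ c :: d, c \notin b ++ d & is_word (b ++ d)].
Proof.
case: w => [|c w] ww; [by left | right].
have := ww c (mem_head _ _); rewrite /= eqxx add1n => -[cw].
have : c \in w by rewrite -has_pred1 has_count cw.
move=> cin; case/splitPr: cin ww cw => b d ww cw; exists c, b, d.
have cbd : count_mem c (b ++ d) = 0%N.
  by move: cw; rewrite !count_cat /= eqxx addnCA add1n => -[].
split=> //; first by rewrite -has_pred1 has_count cbd.
move=> e ebd; have ec : e != c.
  by apply: contraTneq ebd => ->; rewrite -has_pred1 has_count cbd.
have := ww e; rewrite !inE !mem_cat !inE /= !count_cat /= ![c == e]eq_sym.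
rewrite (negPf ec) /= => <- //; by move: ebd; rewrite mem_cat.
Qed.

Lemma word_so_invariant w : is_word w ->
  so_invariant (size w) (fun s => (compatible w s)%:R : R).
Proof.
move: {2}(size w) (leqnn (size w)) => m; elim: m w => [|m IH] w.
  by rewrite leqn0 => /eqP w0 _ X _ s; rewrite w0 => /size0nil ->.
move=> wm /is_word_pair[-> X Xs [|//] //|[c [b [d [wE cbd bdw]]]]] X Xs s.
rewrite wE; case: s => [//|x s] [ss].
have : size (take (size b) s) = size b.
  by rewrite size_takel // ss size_cat leq_addr.
have : size (drop (size b) s) = (size d).+1.
  by rewrite size_drop ss size_cat addKn.
rewrite -[X in act _ _ (x :: X)](cat_take_drop (size b) s).
move: (take _ s) (drop _ s) => b' [//|y d'] [sd] sb.
rewrite /= act_cat /=.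
have bdm : (size (b ++ d) <= m)%N.
  by move: wm; rewrite wE /= !size_cat /= addnS !ltnS => /ltnW.
have sbd : size (b' ++ d') = size (b ++ d) by rewrite !size_cat sb sd.
have Xa k l : X k l = - X l k.
  by move/matrixP: Xs => /(_ l k); rewrite !mxE.
pose t s := (compatible (b ++ d) s)%:R : R.
have D (i j : 'I_n) u v : size u = size b ->
    (compatible (c :: b ++ c :: d) (i :: u ++ j :: v))%:R =
    (i == j)%:R * t (u ++ v) :> R.
  by move=> su; rewrite compatible_pair // -natrM mulnb.
have -> : \sum_k X x k * (compatible (c :: b ++ c :: d) (k :: b' ++ y :: d'))%:R =
    X x y * t (b' ++ d').
  rewrite (bigD1 y) //= big1 ?addr0 ?D ?eqxx ?mul1r // => k /negPf ky.
  by rewrite D // ky mul0r mulr0.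
have -> : \sum_k X y k * (compatible (c :: b ++ c :: d) (x :: b' ++ k :: d'))%:R =
    X y x * t (b' ++ d').
  rewrite (bigD1 x) //= big1 ?addr0 ?D ?eqxx ?mul1r // => k /negPf ky.
  by rewrite D // eq_sym ky mul0r mulr0.
rewrite (@eq_act _ _ _ _ (fun u => (x == y)%:R * t (u ++ d'))); last first.
  by move=> u us; rewrite D // us.
rewrite (@eq_act _ _ _ (fun u => (compatible _ (x :: b' ++ _ :: u))%:R)
  (fun u => (x == y)%:R * t (b' ++ u))); last first.
  by move=> u us; rewrite D.
have := IH _ bdm bdw X Xs _ sbd; rewrite act_cat -/t !actZ => H.
(* The actions on the two slots of [c] cancel because [X] is skew; what is left is a multiple of the
   action on the shorter word's tensor. *)
rewrite (Xa y x) mulNr addrCA addNKr.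
by rewrite -mulrDr H mulr0.
Qed.

Lemma sum_tuple m (G : seq 'I_n -> R) :
  \sum_(s : m.-tuple 'I_n) G s = sumseq m G.
Proof.
elim: m G => [|m IH] G /=.
  rewrite (bigD1 [tuple]) //= big1 ?addr0 // => s.
  by rewrite (tuple0 s) => /eqP.
under [RHS]eq_bigr do rewrite -IH.
rewrite pair_big /= (reindex (fun p : 'I_n * m.-tuple 'I_n => [tuple of p.1 :: p.2])) //=.
exists (fun s : m.+1.-tuple 'I_n => (thead s, [tuple of behead s])) => [[i s]|s] _ /=.
  by rewrite theadE; congr pair; apply: val_inj.
by rewrite -tuple_eta.
Qed.

Definition eval_word w (phi : {ffun seq_sub w -> 'I_n}) : (size w).-tuple 'I_n :=
  [tuple phi (letter j) | j < size w].

(** Assignments of indices to letters correspond bijectively to compatible multi-indices. *)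
Lemma sum_eval_word w (G : seq 'I_n -> R) :
  \sum_(phi : {ffun seq_sub w -> 'I_n}) G (eval_word phi) =
  sumseq (size w) (fun s => (compatible w s)%:R * G s).
Proof.
have lw (l : seq_sub w) : (index (ssval l) w < size w)%N by rewrite index_mem ssvalP.
(* The inverse reads the index of a letter at its first occurrence; compatibility ensures that the
   other occurrences agree. *)
pose h' (s : (size w).-tuple 'I_n) : {ffun seq_sub w -> 'I_n} :=
  [ffun l => tnth s (Ordinal (lw l))].
have zipP (s : (size w).-tuple 'I_n) u : u \in zip w s ->
    exists j : 'I_(size w), u = (ssval (letter j), tnth s j).
  move=> us; have x0 : 'I_n by case: u us.
  case: (nthP (u.1, x0) us) => j.
  rewrite size_zip size_tuple minnn => jw <-; exists (Ordinal jw).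
  rewrite nth_zip ?size_tuple //= (tnth_nth u.1) (tnth_nth x0) //.
have zipM (s : (size w).-tuple 'I_n) (j : 'I_(size w)) :
    (ssval (letter j), tnth s j) \in zip w s.
  have x0 := tnth s j; have y0 := tnth (in_tuple w) j.
  rewrite /= (tnth_nth x0) (tnth_nth y0) /= -nth_zip ?size_tuple //.
  by rewrite mem_nth // size_zip size_tuple minnn.
rewrite -sum_tuple [RHS]big_mkcond /=.
transitivity (\sum_(s : (size w).-tuple 'I_n | compatible w s) G s); last first.
  rewrite big_mkcond; apply: eq_bigr => s _.
  by case: ifP => _; rewrite ?mul1r ?mul0r.
rewrite (reindex_onto (@eval_word w) h').
  apply: eq_bigl => phi; apply/esym/andP; split.
    apply/compatibleP => u v /zipP[j ->] /zipP[k ->] /= e.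
    by rewrite !tnth_mktuple; congr (phi _); apply: val_inj.
  apply/eqP/ffunP => l; rewrite ffunE tnth_mktuple; congr (phi _).
  by apply: val_inj; rewrite /= (tnth_nth (ssval l)) /= nth_index // ssvalP.
move=> s /compatibleP cs; apply: eq_from_tnth => j.
rewrite tnth_mktuple ffunE.
apply: (cs (_, _) (_, _) (zipM s _) (zipM s j)) => /=.
by rewrite (tnth_nth (ssval (letter j))) /= nth_index // mem_tnth.
Qed.

End WordTensor.

(** * Passage from coordinate components to frame components *)

Section Frames.
Variables (R : realType) (n : nat).

(** Components, with respect to the frame formed by the rows of [E], of the tensor with coordinate
    components [F]. *)
Fixpoint ev (E : 'M[R]_n) (F : seq 'I_n -> R) (s : seq 'I_n) : R :=
  if s is a :: s' then \sum_k E a k * ev E (fun u => F (k :: u)) s' else F [::].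

Lemma tensor_evalE m (A : tensor R n) x (E : 'M[R]_n) (s : m.-tuple 'I_n) :
  tensor_eval A x (fun j => row (tnth s j) E) = ev E (fun u => A u x) s.
Proof.
pose F u := A u x.
have -> : tensor_eval A x (fun j => row (tnth s j) E) =
   \sum_(I : m.-tuple 'I_n) (\prod_(j < m) E (tnth s j) (tnth I j)) * F I.
  by apply: eq_bigr => I _; congr (_ * _); apply: eq_bigr => j _; rewrite mxE.
rewrite -[fun u => A u x]/F; move: F => F; elim: m s F => [|m IH] s F.
  rewrite (tuple0 s) (bigD1 [tuple]) //= big_ord0 mul1r big1 ?addr0 // => I.
  by rewrite (tuple0 I) => /eqP.
have es : tval s = thead s :: behead s by rewrite [in LHS](tuple_eta s).
rewrite [X in ev E F X]es /=.
under [RHS]eq_bigr do rewrite -(IH [tuple of behead s]) mulr_sumr.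
rewrite pair_big /= (reindex (fun p : 'I_n * m.-tuple 'I_n => [tuple of p.1 :: p.2])) /=.
  apply: eq_bigr => -[i I] _ /=; rewrite big_ord_recl mulrA; congr (_ * _ * _).
  by apply: eq_bigr => j _; congr (E _ _); rewrite !(tnth_nth i) //= es.
exists (fun s : m.+1.-tuple 'I_n => (thead s, [tuple of behead s])) => [[i I]|I] _ /=.
  by rewrite theadE; congr pair; apply: val_inj.
by rewrite -tuple_eta.
Qed.

Lemma word_derivE (g : 'rV[R]_n -> 'M[R]_n) (T : choiceType) (w : seq T) E x h :
  word_deriv g w E x h = sumseq (size w) (fun s => (compatible w s)%:R *
    ev E (fun u => iter_cov_deriv g (size w) h u x) s).
Proof.
rewrite -sum_eval_word; apply: eq_bigr => phi _; rewrite -tensor_evalE.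
apply: eq_bigr => I _; congr (_ * _); apply: eq_bigr => j _.
by rewrite tnth_mktuple.
Qed.

Lemma ev_cat (E : 'M[R]_n) F a b :
  ev E F (a ++ b) = ev E (fun u => ev E (fun v => F (u ++ v)) b) a.
Proof. by elim: a F => //= x a IH F; apply: eq_bigr => k _; rewrite IH. Qed.

Lemma eq_ev E F F' s : (forall u, size u = size s -> F u = F' u) ->
  ev E F s = ev E F' s.
Proof.
elim: s F F' => /= [|x s IH] F F' e; first exact: e.
apply: eq_bigr => k _; congr (_ * _); apply: IH => u us.
by rewrite e //= us.
Qed.

Lemma evD E F F' s : ev E (fun u => F u + F' u) s = ev E F s + ev E F' s.
Proof.
elim: s F F' => //= x s IH F F'; rewrite -big_split /=.
by apply: eq_bigr => k _; rewrite IH mulrDr.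
Qed.

Lemma evZ E c F s : ev E (fun u => c * F u) s = c * ev E F s.
Proof.
elim: s F => //= x s IH F; rewrite mulr_sumr.
by apply: eq_bigr => k _; rewrite IH mulrCA.
Qed.

Lemma evB E F F' s : ev E (fun u => F u - F' u) s = ev E F s - ev E F' s.
Proof.
rewrite evD -mulN1r -evZ; congr (_ + _).
by apply: eq_ev => u _; rewrite mulN1r.
Qed.

Lemma ev_sum E (J : finType) (F : J -> seq 'I_n -> R) s :
  ev E (fun u => \sum_j F j u) s = \sum_j ev E (F j) s.
Proof.
elim: s F => //= x s IH F; rewrite exchange_big /=.
by apply: eq_bigr => k _; rewrite IH mulr_sumr.
Qed.

Lemma ev_ev E (G : seq 'I_n -> seq 'I_n -> R) a b :
  ev E (fun v => ev E (G^~ v) a) b = ev E (fun u => ev E (G u) b) a.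
Proof.
elim: a G => //= x a IH G; rewrite ev_sum; apply: eq_bigr => k _.
by rewrite evZ (IH (fun u => G (k :: u))).
Qed.

Lemma act_ev_comm X E (G : seq 'I_n -> seq 'I_n -> R) a s :
  act X (fun v => ev E (G^~ v) a) s = ev E (fun u => act X (G u) s) a.
Proof.
elim: a G => //= x a IH G; rewrite act_sum; apply: eq_bigr => k _.
by rewrite actZ (IH (fun u => G (k :: u))).
Qed.

(** The hypothesis says that [X] and [Y] represent one endomorphism, in the frame and in coordinates
    respectively, when [E] is a frame. *)
Lemma act_ev X Y E F s : X *m E = E *m Y ->
  act X (ev E F) s = ev E (act Y F) s.
Proof.
move=> XE; elim: s F => //= x s IH F.
under [RHS]eq_bigr => k _.
  rewrite evD -IH ev_sum mulrDr mulr_sumr.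
  under eq_bigr do rewrite evZ mulrA.
  over.
rewrite big_split /=; congr (_ + _); last first.
  rewrite act_sum; apply: eq_bigr => k _; exact: actZ.
transitivity (\sum_k (X *m E) x k * ev E (fun u => F (k :: u)) s).
  under eq_bigr do rewrite mulr_sumr.
  rewrite exchange_big; apply: eq_bigr => k _; rewrite mxE mulr_suml.
  by apply: eq_bigr => j _; rewrite mulrA.
rewrite XE [RHS]exchange_big; apply: eq_bigr => k _; rewrite mxE mulr_suml.
by apply: eq_bigr => j _.
Qed.

End Frames.

(** * Smooth functions on an open set *)

Local Open Scope classical_set_scope.

Section Smoothness.
Variables (R : realType) (n : nat) (V : set 'rV[R]_n).
Hypothesis openV : open V.
Implicit Types (h f : 'rV[R]_n -> R) (x : 'rV[R]_n).

Lemma near_eq_on h f x : V x -> {in V, h =1 f} -> {near x, h =1 f}.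
Proof.
move=> Vx e; near=> y; apply: e; rewrite inE; near: y.
exact: open_nbhs_nbhs.
Unshelve. all: by end_near. Qed.

Lemma eq_pderiv i h f x : V x -> {in V, h =1 f} ->
  pderiv i h x = pderiv i f x.
Proof. by move=> Vx e; apply: near_eq_derive; apply: near_eq_on. Qed.

Lemma smooth_cont h x : smooth_on V h -> V x -> {for x, continuous h}.
Proof. by move=> sh Vx; case: (sh [::] x Vx). Qed.

Lemma smooth_derivable h x i : smooth_on V h -> V x -> derivable h x (delta_mx 0 i).
Proof. by move=> sh Vx; case: (sh [::] x Vx) => _; apply. Qed.

Lemma smooth_pderiv h i : smooth_on V h -> smooth_on V (pderiv i h).
Proof. by move=> sh s x Vx; have := sh (rcons s i) x Vx; rewrite foldr_rcons. Qed.

(** A form of smoothness graded by the order. Derivatives of products and inverses involve the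
    functions themselves again, so closure is proved by induction on [k]. *)
Fixpoint Ck k h : Prop :=
  (forall x, V x -> {for x, continuous h}) /\
  if k is k'.+1 then
    (forall x i, V x -> derivable h x (delta_mx 0 i)) /\
    forall i, Ck k' (pderiv i h)
  else True.

Lemma smooth_onP h : smooth_on V h <-> forall k, Ck k h.
Proof.
split=> [sh k|].
  elim: k h sh => [|k IH] h sh /=; split=> //; try by move=> x; exact: smooth_cont.
  by split=> [x i|i]; [exact: smooth_derivable | apply/IH/smooth_pderiv].
move=> ch s; have {ch} := ch (size s).+1; elim/last_ind: s h => [|s i IH] h.
  by move=> [ch [dh _]] x Vx; split=> [|i]; [exact: ch | exact: dh].
by rewrite size_rcons => -[_ [_ /(_ i) /IH]]; rewrite foldr_rcons.
Qed.

Lemma CkW k h : Ck k.+1 h -> Ck k h.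
Proof.
elim: k h => [|k IH] h [ch [dh ph]]; first by split.
by split=> //; split=> // i; apply: IH.
Qed.

Lemma eq_continuous_on h f x : V x -> {in V, h =1 f} ->
  {for x, continuous h} -> {for x, continuous f}.
Proof.
move=> Vx e ch; have exf : h x = f x by apply: e; rewrite inE.
rewrite /prop_for /continuous_at -exf; apply: cvg_trans ch.
by apply: (@near_eq_cvg _ _ (nbhs x)); apply: near_eq_on => // y Vy; rewrite e.
Qed.

Lemma eq_Ck k h f : {in V, h =1 f} -> Ck k h -> Ck k f.
Proof.
elim: k h f => [|k IH] h f e [ch H].
  by split=> // x Vx; apply: eq_continuous_on (ch x Vx).
have [dh ph] := H; split; first by move=> x Vx; apply: eq_continuous_on (ch x Vx).
split=> [x i Vx|i].
  by apply: near_eq_derivable (dh x i Vx); apply: near_eq_on.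
by apply: IH (ph i) => x; rewrite inE => Vx; apply: eq_pderiv.
Qed.

Lemma eq_smooth h f : {in V, h =1 f} -> smooth_on V h -> smooth_on V f.
Proof. by move=> e /smooth_onP sh; apply/smooth_onP => k; apply: eq_Ck (sh k). Qed.

Lemma pderiv_cst i (c : R) x : pderiv i (fun=> c) x = 0.
Proof. exact: derive_cst. Qed.

Lemma Ck_cst k (c : R) : Ck k (fun=> c).
Proof.
elim: k c => [|k IH] c /=; split=> //; try by move=> x _; exact: cst_continuous.
split=> [x i _|i]; first exact: derivable_cst.
apply: (@eq_Ck k (fun=> 0)); last exact: IH.
by move=> x _; rewrite pderiv_cst.
Qed.

Lemma CkD k h f : Ck k h -> Ck k f -> Ck k (fun y => h y + f y).
Proof.
elim: k h f => [|k IH] h f [ch H] [cf H'].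
  by split=> // x Vx; exact: cvgD (ch x Vx) (cf x Vx).
case: H => dh ph; case: H' => df pf; split.
  by move=> x Vx; exact: cvgD (ch x Vx) (cf x Vx).
split=> [x i Vx|i]; first by apply: derivableD; [exact: dh | exact: df].
apply: eq_Ck (IH _ _ (ph i) (pf i)) => x; rewrite inE => Vx.
by apply/esym/deriveD; [exact: dh | exact: df].
Qed.

Lemma CkM k h f : Ck k h -> Ck k f -> Ck k (fun y => h y * f y).
Proof.
elim: k h f => [|k IH] h f [ch H] [cf H'].
  by split=> // x Vx; exact: cvgM (ch x Vx) (cf x Vx).
case: (H) => dh ph; case: (H') => df pf; split.
  by move=> x Vx; exact: cvgM (ch x Vx) (cf x Vx).
split=> [x i Vx|i]; first by apply: derivableM; [exact: dh | exact: df].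
have ck := CkW (conj ch H); have ck' := CkW (conj cf H').
apply: eq_Ck (CkD (IH _ _ ck (pf i)) (IH _ _ ck' (ph i))) => x; rewrite inE => Vx.
by apply/esym/deriveM; [exact: dh | exact: df].
Qed.

Lemma CkV k h : (forall x, V x -> h x != 0) -> Ck k h -> Ck k (fun y => (h y)^-1).
Proof.
move=> h0; elim: k => [|k IH] [ch H].
  by split=> // x Vx; exact: cvgV (h0 x Vx) (ch x Vx).
case: (H) => dh ph; split.
  by move=> x Vx; exact: cvgV (h0 x Vx) (ch x Vx).
split=> [x i Vx|i]; first by apply: derivableV; [exact: h0 | exact: dh].
have ck := IH (CkW (conj ch H)).
apply: eq_Ck (CkM (Ck_cst k (-1)) (CkM (CkM ck ck) (ph i))) => x.
rewrite inE => Vx; rewrite /pderiv (deriveV (h0 _ Vx)) //=; last exact: dh.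
by rewrite mulN1r scaleNr -exprVn expr2.
Qed.

Lemma smooth_cst (c : R) : smooth_on V (fun=> c).
Proof. by apply/smooth_onP => k; apply: Ck_cst. Qed.

Lemma smoothD h f : smooth_on V h -> smooth_on V f -> smooth_on V (fun y => h y + f y).
Proof. by move=> /smooth_onP ? /smooth_onP ?; apply/smooth_onP => k; apply: CkD. Qed.

Lemma smoothM h f : smooth_on V h -> smooth_on V f -> smooth_on V (fun y => h y * f y).
Proof. by move=> /smooth_onP ? /smooth_onP ?; apply/smooth_onP => k; apply: CkM. Qed.

Lemma smoothV h : (forall x, V x -> h x != 0) ->
  smooth_on V h -> smooth_on V (fun y => (h y)^-1).
Proof. by move=> ? /smooth_onP ?; apply/smooth_onP => k; apply: CkV. Qed.

Lemma smoothN h : smooth_on V h -> smooth_on V (fun y => - h y).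
Proof.
move=> sh; apply: eq_smooth (smoothM (smooth_cst (-1)) sh) => y _.
by rewrite mulN1r.
Qed.

Lemma smoothB h f : smooth_on V h -> smooth_on V f -> smooth_on V (fun y => h y - f y).
Proof. by move=> sh sf; exact: smoothD sh (smoothN sf). Qed.

Lemma smooth_sum (J : Type) (r : seq J) (P : pred J) (h : J -> 'rV[R]_n -> R) :
  (forall j, smooth_on V (h j)) -> smooth_on V (fun y => \sum_(j <- r | P j) h j y).
Proof.
move=> sh; elim: r => [|j r IH].
  by apply: eq_smooth (smooth_cst 0) => y _; rewrite big_nil.
case Pj: (P j); last by apply: eq_smooth IH => y _; rewrite big_cons Pj.
by apply: eq_smooth (smoothD (sh j) IH) => y _; rewrite big_cons Pj.
Qed.

Lemma smooth_prod (J : Type) (r : seq J) (P : pred J) (h : J -> 'rV[R]_n -> R) :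
  (forall j, smooth_on V (h j)) -> smooth_on V (fun y => \prod_(j <- r | P j) h j y).
Proof.
move=> sh; elim: r => [|j r IH].
  by apply: eq_smooth (smooth_cst 1) => y _; rewrite big_nil.
case Pj: (P j); last by apply: eq_smooth IH => y _; rewrite big_cons Pj.
by apply: eq_smooth (smoothM (sh j) IH) => y _; rewrite big_cons Pj.
Qed.

Lemma smooth_det m (M : 'rV[R]_n -> 'M[R]_m) :
  (forall i j, smooth_on V (fun y => M y i j)) -> smooth_on V (fun y => \det (M y)).
Proof.
move=> sM; apply: smooth_sum => s; apply: smoothM; first exact: smooth_cst.
by apply: smooth_prod => j; apply: sM.
Qed.

(** By Cramer's rule the entries are cofactors divided by the determinant. *)
Lemma smooth_invmx (M : 'rV[R]_n -> 'M[R]_n) :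
  (forall y, V y -> M y \in unitmx) ->
  (forall i j, smooth_on V (fun y => M y i j)) ->
  forall i j, smooth_on V (fun y => invmx (M y) i j).
Proof.
move=> uM sM i j.
have sa : smooth_on V (fun y => (\det (M y))^-1 * cofactor (M y) j i).
  apply: smoothM.
    apply: smoothV; last exact: smooth_det.
    by move=> y /uM; rewrite unitmxE unitfE.
  apply: smoothM; first exact: smooth_cst.
  apply: smooth_det => k l.
  by apply: eq_smooth (sM (lift j k) (lift i l)) => y _; rewrite !mxE.
by apply: eq_smooth sa => y; rewrite inE => Vy; rewrite /invmx uM // !mxE.
Qed.

Lemma pderivD i h f x : smooth_on V h -> smooth_on V f -> V x ->
  pderiv i (fun y => h y + f y) x = pderiv i h x + pderiv i f x.
Proof. by move=> sh sf Vx; apply: deriveD; apply: smooth_derivable. Qed.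

Lemma pderivM i h f x : smooth_on V h -> smooth_on V f -> V x ->
  pderiv i (fun y => h y * f y) x = pderiv i h x * f x + h x * pderiv i f x.
Proof.
move=> sh sf Vx; rewrite addrC [pderiv i h x * _]mulrC.
by apply: deriveM; apply: smooth_derivable.
Qed.

Lemma pderivN i h x : smooth_on V h -> V x ->
  pderiv i (fun y => - h y) x = - pderiv i h x.
Proof. by move=> sh Vx; apply: deriveN; apply: smooth_derivable. Qed.

Lemma pderivB i h f x : smooth_on V h -> smooth_on V f -> V x ->
  pderiv i (fun y => h y - f y) x = pderiv i h x - pderiv i f x.
Proof. by move=> sh sf Vx; apply: deriveB; apply: smooth_derivable. Qed.

Lemma pderiv_sum i m (h : 'I_m -> 'rV[R]_n -> R) x :
  (forall j, smooth_on V (h j)) -> V x ->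
  pderiv i (fun y => \sum_j h j y) x = \sum_j pderiv i (h j) x.
Proof.
move=> sh Vx; rewrite /pderiv -derive_sum; last by move=> j; apply: smooth_derivable.
by congr ('D_ _ _ x); apply/funext => y; rewrite fct_sumE.
Qed.

End Smoothness.

(** * Symmetry of second partial derivatives *)

Section Schwarz.
Variables (R : realType) (n : nat).
Implicit Types (h : 'rV[R]_n -> R) (x y u v : 'rV[R]_n).

Lemma is_derive_line h y u (s : R) : derivable h (y + s *: u) u ->
  is_derive s 1 (fun r : R => h (y + r *: u)) ('D_u h (y + s *: u)).
Proof.
have e : (fun r : R => r^-1 *: ((h \o shift (y + s *: u)) (r *: u) - h (y + s *: u)))
  = (fun r : R => r^-1 *: (((fun r => h (y + r *: u)) \o shift s) (r *: 1) -
      (fun r => h (y + r *: u)) s)).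
  apply/funext => r /=; congr (_ *: (h _ - _)).
  by rewrite scalerDl [r *: 1]mulr1 addrCA addrA addrC addrA.
rewrite /derivable e => dh; split; first exact: dh.
by rewrite /derive e.
Qed.

Lemma mvt_line h y u (d : R) : 0 < d ->
  (forall s, 0 <= s <= d -> derivable h (y + s *: u) u) ->
  exists2 s, 0 < s < d & h (y + d *: u) - h y = 'D_u h (y + s *: u) * d.
Proof.
move=> d0 dh; pose f (r : R) := h (y + r *: u).
have [| |s] := @MVT R f (fun s => 'D_u h (y + s *: u)) 0 d d0.
- move=> s; rewrite in_itv /= => /andP[s0 sd].
  by apply: is_derive_line; apply: dh; rewrite !ltW.
- apply: derivable_within_continuous => s; rewrite in_itv /= => sd.
  by have [] := is_derive_line (dh s sd).
rewrite in_itv /= => sd; rewrite /f scale0r addr0 subr0 => e.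
by exists s.
Qed.

(** Two uses of the mean value theorem: along [u] for the difference of [h] on two parallel
    segments, then along [v] for the derivative of [h] in direction [u]. *)
Lemma second_difference (V : set 'rV[R]_n) h x u v (d : R) : 0 < d ->
  (forall s t, 0 <= s <= d -> 0 <= t <= d -> V (x + s *: u + t *: v)) ->
  (forall y, V y -> derivable h y u) ->
  (forall y, V y -> derivable ('D_u h) y v) ->
  exists s t, [/\ 0 < s < d, 0 < t < d &
    h (x + d *: u + d *: v) - h (x + d *: u) - (h (x + d *: v) - h x) =
    'D_v ('D_u h) (x + s *: u + t *: v) * d * d].
Proof.
move=> d0 box du dvu.
have dd : 0 <= d <= d by rewrite ltW // lexx.
have z0 : 0 <= (0 : R) <= d by rewrite lexx ltW.
pose f (r : R) := h (x + d *: v + r *: u) - h (x + r *: u).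
pose df (r : R) := 'D_u h (x + d *: v + r *: u) - 'D_u h (x + r *: u).
have fd s : 0 <= s <= d -> is_derive s 1 f (df s).
  move=> sd; apply: is_deriveB; apply: is_derive_line; apply: du.
    by rewrite addrAC; apply: box.
  by have := box s 0 sd z0; rewrite scale0r addr0.
have [| |s] := @MVT R f df 0 d d0.
- by move=> s; rewrite in_itv /= => /andP[s0 sd]; apply: fd; rewrite !ltW.
- apply: derivable_within_continuous => s; rewrite in_itv /= => sd.
  by have [] := fd _ sd.
rewrite in_itv /= subr0 /f /df !scale0r !addr0 => sd e.
have sd' : 0 <= s <= d by case/andP: sd => s0 sd; rewrite !ltW.
have [|t td et] := @mvt_line ('D_u h) (x + s *: u) v d d0.
  by move=> t td; apply: dvu; apply: box.
exists s, t; split=> //.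
by rewrite [x + d *: u + d *: v]addrAC e [x + d *: v + _]addrAC et.
Qed.

Lemma small_box (V : set 'rV[R]_n) x u v : nbhs x V ->
  exists2 d : R, 0 < d &
    forall s t, 0 <= s <= d -> 0 <= t <= d -> V (x + s *: u + t *: v).
Proof.
move=> /nbhs_ballP[e /= e0 eV].
have b0 : 0 < `|u| + `|v| + 1 by rewrite ltr_wpDl // addr_ge0.
exists (e / 2 / (`|u| + `|v| + 1)); first by rewrite !divr_gt0.
set d := _ / _ => s t /andP[s0 sd] /andP[t0 td]; apply: eV.
rewrite -ball_normE /= -addrA opprD addrA subrr sub0r normrN.
apply: le_lt_trans (ler_normD _ _) _; rewrite !normrZ !ger0_norm //.
have : s * `|u| + t * `|v| <= d * (`|u| + `|v| + 1).
  rewrite !mulrDr mulr1 -addrA lerD ?ler_wpM2r //.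
  by rewrite ler_wpDr ?ler_wpM2r // (le_trans s0).
rewrite /d divfK ?gt_eqF // => /le_lt_trans; apply.
by rewrite ltr_pdivrMr // ltr_pMr // ltr1n.
Qed.

(** The same second difference is a value of either mixed derivative at a point near [x]. Were the
    two derivatives distinct at [x], continuity would keep their nearby values apart. *)
Lemma schwarz (V : set 'rV[R]_n) h x u v : open V -> V x ->
  (forall y, V y -> derivable h y u) -> (forall y, V y -> derivable h y v) ->
  (forall y, V y -> derivable ('D_u h) y v) ->
  (forall y, V y -> derivable ('D_v h) y u) ->
  {for x, continuous ('D_v ('D_u h))} -> {for x, continuous ('D_u ('D_v h))} ->
  'D_v ('D_u h) x = 'D_u ('D_v h) x.
Proof.
move=> oV Vx du dv dvu duv c1 c2.
set A := 'D_v _ in c1 *; set B := 'D_u ('D_v h) in c2 *.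
apply/eqP/negPn/negP => AB.
have e0 : 0 < `|A x - B x| / 2 by rewrite divr_gt0 // normr_gt0 subr_eq0.
set e := _ / 2 in e0.
pose W := V `&` [set y | `|A x - A y| < e] `&` [set y | `|B x - B y| < e].
have nW : nbhs x W.
  apply: filterI; first apply: filterI.
  - exact: open_nbhs_nbhs.
  - by move/cvgrPdist_lt: c1 => /(_ e e0).
  - by move/cvgrPdist_lt: c2 => /(_ e e0).
have [d d0 box] := small_box u v nW.
have [s [t [sd td E]]] := @second_difference V h x u v d d0
  (fun s t sd td => (box s t sd td).1.1) du dvu.
have box' s' t' : 0 <= s' <= d -> 0 <= t' <= d -> W (x + s' *: v + t' *: u).
  by move=> sd' td'; rewrite addrAC; apply: box.
have [s' [t' [sd' td' E']]] := @second_difference V h x v u d d0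
  (fun s t sd td => (box' s t sd td).1.1) dv duv.
have W1 : W (x + s *: u + t *: v).
  by case/andP: sd => ? ?; case/andP: td => ? ?; apply: box; rewrite !ltW.
have W2 : W (x + s' *: v + t' *: u).
  by case/andP: sd' => ? ?; case/andP: td' => ? ?; apply: box'; rewrite !ltW.
have EE : A (x + s *: u + t *: v) = B (x + s' *: v + t' *: u).
  apply: (mulIf (lt0r_neq0 d0)); apply: (mulIf (lt0r_neq0 d0)).
  rewrite /A /B; apply: etrans (esym E) (etrans _ E').
  rewrite [x + d *: u + d *: v]addrAC.
  by move: (h (_ + _ + _)) (h (_ + _)) (h (_ + _)) (h x) => a b c e'; ring.
have := W1.1.2; have := W2.2; rewrite /= -EE; set y := A (_ + _).
move=> b1 b2; have : `|A x - B x| < e + e.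
  rewrite (_ : A x - B x = (A x - y) - (B x - y)); last by ring.
  exact: le_lt_trans (ler_normB _ _) (ltrD b2 b1).
by rewrite /e -splitr ltxx.
Qed.
End Schwarz.

Lemma pderivC (R : realType) (n : nat) (V : set 'rV[R]_n) h x i j : open V ->
  smooth_on V h -> V x -> pderiv i (pderiv j h) x = pderiv j (pderiv i h) x.
Proof.
move=> oV sh Vx; have sp k := smooth_pderiv k sh.
have d k f : smooth_on V f -> forall y, V y -> derivable f y (delta_mx 0 k).
  by move=> sf y; apply: smooth_derivable.
exact: (schwarz oV Vx (d j _ sh) (d i _ sh) (d i _ (sp j)) (d j _ (sp i))
  (smooth_cont (smooth_pderiv i (sp j)) Vx)
  (smooth_cont (smooth_pderiv j (sp i)) Vx)).
Qed.

(** * Local Riemannian geometry *)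

(** Recognizes the correction term of [cov_deriv] as a derivation action. The index [i] is only the
    default of [nth]. *)
Lemma sum_nth_act (R : realType) (n : nat) (X : 'M[R]_n) t (J : seq 'I_n) (i : 'I_n) :
  \sum_(j < size J) \sum_(k < n) X (nth i J j) k * t (set_nth i J j k) = act X t J.
Proof.
elim: J t => [|x J IH] t /=; first by rewrite big_ord0.
by rewrite big_ord_recl /=; congr (_ + _); rewrite -IH.
Qed.

Section LocalGeometry.
Variables (R : realType) (n : nat) (V : set 'rV[R]_n) (g : 'rV[R]_n -> 'M[R]_n).
Hypothesis openV : open V.
Hypothesis smooth_g : forall i j, smooth_on V (fun y => g y i j).
Hypothesis sym_g : forall y, V y -> (g y)^T = g y.
Hypothesis unit_g : forall y, V y -> g y \in unitmx.
Implicit Types (A B : tensor R n) (x : 'rV[R]_n).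

Lemma g_sym y i j : V y -> g y i j = g y j i.
Proof. by move=> /sym_g/matrixP/(_ j i); rewrite mxE. Qed.

Lemma pderiv_g_sym k i j y : V y ->
  pderiv k (fun z => g z i j) y = pderiv k (fun z => g z j i) y.
Proof.
by move=> Vy; apply: (eq_pderiv openV) => // z; rewrite inE => /g_sym.
Qed.

Definition smooth_tensor A := forall J, smooth_on V (A J).

(** Row [j] holds the components of the derivative of the [j]-th coordinate field in direction [i],
    matching the row convention of [act]. *)
Definition connection i x : 'M[R]_n := \matrix_(j, k) christoffel g x k i j.

Lemma smooth_christoffel k i j : smooth_on V (fun y => christoffel g y k i j).
Proof.
rewrite /christoffel.
apply: (@smoothM _ _ _ openV (fun=> 2^-1)); first exact: smooth_cst.
apply: (smooth_sum openV) => l; apply: (smoothM openV); first exact: smooth_invmx.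
by apply: (smoothB openV); first apply: (smoothD openV);
  apply: smooth_pderiv; exact: smooth_g.
Qed.

Lemma smooth_connection i j k : smooth_on V (fun y => connection i y j k).
Proof.
by apply: (eq_smooth openV) (smooth_christoffel k i j) => y _; rewrite mxE.
Qed.

Lemma christoffelC k i j y : V y -> christoffel g y k i j = christoffel g y k j i.
Proof.
move=> Vy; congr (_ * _); apply: eq_bigr => l _; congr (_ * (_ - _)).
  exact: addrC.
exact: pderiv_g_sym.
Qed.

Lemma cov_derivE A i J x :
  cov_deriv g A (i :: J) x = pderiv i (A J) x - act (connection i x) (A^~ x) J.
Proof.
rewrite /= -(sum_nth_act _ _ _ i); congr (_ - _).
by apply: eq_bigr => j _; apply: eq_bigr => k _; rewrite mxE.
Qed.

Lemma smooth_act (M : 'rV[R]_n -> 'M[R]_n) A J :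
  (forall i j, smooth_on V (fun y => M y i j)) -> smooth_tensor A ->
  smooth_on V (fun y => act (M y) (A^~ y) J).
Proof.
move=> sM; elim: J A => [|x J IH] A sA /=; first exact: smooth_cst.
apply: (smoothD openV); last by apply: (IH (fun J => A (x :: J))) => K.
by apply: (smooth_sum openV) => k; apply: (smoothM openV).
Qed.

Lemma smooth_cov_deriv A : smooth_tensor A -> smooth_tensor (cov_deriv g A).
Proof.
move=> sA [|i J]; first exact: smooth_cst.
apply: (eq_smooth openV) (_ : smooth_on V (fun y => pderiv i (A J) y -
   act (connection i y) (A^~ y) J)) => [y _|]; first by rewrite cov_derivE.
apply: (smoothB openV); first exact: smooth_pderiv.
by apply: smooth_act sA => k l; exact: smooth_connection.
Qed.

Lemma smooth_iter_cov_deriv A m :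
  smooth_tensor A -> smooth_tensor (iter m (cov_deriv g) A).
Proof. by move=> sA; elim: m => [|m IH]; [exact: sA | exact: smooth_cov_deriv]. Qed.

Definition pderiv_mx i (M : 'rV[R]_n -> 'M[R]_n) x : 'M[R]_n :=
  \matrix_(j, k) pderiv i (fun y => M y j k) x.

Lemma pderiv_act i (M : 'rV[R]_n -> 'M[R]_n) A J x :
  (forall i j, smooth_on V (fun y => M y i j)) -> smooth_tensor A -> V x ->
  pderiv i (fun y => act (M y) (A^~ y) J) x =
  act (pderiv_mx i M x) (A^~ x) J + act (M x) (fun u => pderiv i (A u) x) J.
Proof.
move=> sM sA Vx; elim: J A sA => [|k J IH] A sA /=.
  by rewrite pderiv_cst addr0.
have sA' : smooth_tensor (fun u => A (k :: u)) by move=> u; apply: sA.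
have sMA l : smooth_on V (fun y => M y k l * A (l :: J) y) by apply: (smoothM openV).
rewrite (pderivD i (smooth_sum openV _ _ sMA) (smooth_act J sM sA') Vx).
rewrite (pderiv_sum i sMA Vx) (IH _ sA') addrACA -big_split /=; congr (_ + _).
by apply: eq_bigr => l _; rewrite (pderivM i (sM k l) (sA _) Vx) mxE.
Qed.

Definition curvature_mx i j x : 'M[R]_n := \matrix_(k, l) curvature_coef g x i j k l.

(** The structure equation. With endomorphisms acting on row vectors, composition is reversed, hence
    the minus sign before the commutator. *)
Lemma curvature_mxE i j x : curvature_mx i j x =
  pderiv_mx i (connection j) x - pderiv_mx j (connection i) x
  - (connection i x *m connection j x - connection j x *m connection i x).
Proof.
have E a b k l : pderiv a (fun y => connection b y k l) x =
   pderiv a (fun y => christoffel g y l b k) x.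
  by congr (pderiv a _ x); apply/funext => y; rewrite mxE.
apply/matrixP => k l; rewrite !mxE !E /curvature_coef sumrB; congr (_ + _).
rewrite opprB; congr (_ - _); apply: eq_bigr => m _; rewrite !mxE; exact: mulrC.
Qed.

(** After expansion, the second partial derivatives [P] cancel by Schwarz, the corrections [S] in
    the first slot by the symmetry of the Christoffel symbols, and the mixed terms [M] occur
    symmetrically. The terms [D] and [C] assemble to the curvature. *)
Lemma ricci_identity A i j J x : smooth_tensor A -> V x ->
  cov_deriv g (cov_deriv g A) (i :: j :: J) x -
  cov_deriv g (cov_deriv g A) (j :: i :: J) x =
  - act (curvature_mx i j x) (A^~ x) J.
Proof.
move=> sA Vx.
pose P a b := pderiv a (pderiv b (A J)) x.
pose D a b := act (pderiv_mx a (connection b) x) (A^~ x) J.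
pose M a b := act (connection a x) (fun u => pderiv b (A u) x) J.
pose S a b := \sum_k connection a x b k * cov_deriv g A (k :: J) x.
pose C a b := act (connection a x) (act (connection b x) (A^~ x)) J.
have E a b : cov_deriv g (cov_deriv g A) (a :: b :: J) x =
    P a b - (D a b + M b a) - (S a b + (M a b - C a b)).
  rewrite cov_derivE; congr (_ - (_ + _)); last first.
    rewrite /M /C -actB; apply: eq_act => u _; exact: cov_derivE.
  have -> : pderiv a (cov_deriv g A (b :: J)) x =
     pderiv a (fun y => pderiv b (A J) y - act (connection b y) (A^~ y) J) x.
    by congr (pderiv a _ x); apply/funext => y; rewrite cov_derivE.
  have sb k l : smooth_on V (fun y => connection b y k l).
    exact: smooth_connection.
  rewrite (pderivB _ (smooth_pderiv b (sA J)) (smooth_act J sb sA) Vx).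
  by rewrite (pderiv_act _ _ sb sA Vx).
have SC : S i j = S j i.
  by apply: eq_bigr => k _; congr (_ * _); rewrite !mxE (christoffelC _ _ _ Vx).
have PC : P i j = P j i by exact: (pderivC i j openV (sA J) Vx).
have CE : act (curvature_mx i j x) (A^~ x) J = D i j - D j i - (C i j - C j i).
  by rewrite curvature_mxE act_mxB -act_comm act_mxB.
rewrite !E CE SC PC; clearbody P D M S C; ring.
Qed.

Lemma lower_christoffel i j m x : V x ->
  \sum_l christoffel g x l i j * g x l m =
  2^-1 * (pderiv i (fun y => g y j m) x + pderiv j (fun y => g y i m) x
          - pderiv m (fun y => g y i j) x).
Proof.
move=> Vx; pose f p := pderiv i (fun y => g y j p) x + pderiv j (fun y => g y i p) x
          - pderiv p (fun y => g y i j) x.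
transitivity (\sum_p (g x *m invmx (g x)) m p * (2^-1 * f p)).
  under [RHS]eq_bigr do rewrite mxE mulr_suml.
  rewrite exchange_big; apply: eq_bigr => l _.
  rewrite /christoffel -mulrA mulr_suml mulr_sumr; apply: eq_bigr => p _.
  by rewrite (g_sym l m Vx) -/(f p); ring.
rewrite mulmxV ?unit_g // (bigD1 m) //= mxE eqxx mul1r big1 ?addr0 // => p pm.
by rewrite mxE eq_sym (negPf pm) mul0r.
Qed.

Lemma metric_parallel k x : V x ->
  pderiv_mx k g x = connection k x *m g x + g x *m (connection k x)^T.
Proof.
move=> Vx; apply/matrixP => i j; rewrite !mxE.
under eq_bigr do rewrite mxE.
under [X in _ = _ + X]eq_bigr do rewrite !mxE mulrC (g_sym i) //.
rewrite !lower_christoffel // (pderiv_g_sym k j i) //.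
by field.
Qed.

Definition metric_tensor : tensor R n :=
  fun s y => if s is [:: k; l] then g y k l else 0.

Lemma smooth_metric_tensor : smooth_tensor metric_tensor.
Proof.
by move=> [|k [|l [|m J]]]; [exact: (smooth_cst openV 0) |
  exact: (smooth_cst openV 0) | exact: smooth_g | exact: (smooth_cst openV 0)].
Qed.

Lemma cov_deriv_metric s x : V x -> size s = 3%N ->
  cov_deriv g metric_tensor s x = 0.
Proof.
case: s => [|i [|k [|l [|m J]]]] // Vx _; rewrite cov_derivE /= addr0.
have /matrixP/(_ k l) := metric_parallel i Vx.
rewrite !mxE => ->; apply/eqP; rewrite subr_eq0; apply/eqP; congr (_ + _).
by apply: eq_bigr => m _; rewrite [in LHS]mxE mulrC.
Qed.

(** The Ricci identity for the metric itself, whose covariant derivative vanishes. *)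
Lemma curvature_skew i j x : V x ->
  (curvature_mx i j x *m g x)^T = - (curvature_mx i j x *m g x).
Proof.
move=> Vx; apply/matrixP => l k; rewrite [LHS]mxE [LHS]mxE [RHS]mxE [X in - X]mxE.
apply/eqP; rewrite -addr_eq0.
have Z a b : cov_deriv g (cov_deriv g metric_tensor) [:: a; b; k; l] x = 0.
  rewrite cov_derivE (@eq_pderiv _ _ _ openV a _ (fun=> 0)) //; last first.
    by move=> y; rewrite inE => Vy; apply: cov_deriv_metric.
  rewrite pderiv_cst (@eq_act _ _ _ _ (fun=> 0)) ?act0 ?subr0 // => u us.
  exact: cov_deriv_metric.
have := ricci_identity i j [:: k; l] smooth_metric_tensor Vx.
rewrite !Z subrr => /esym/eqP; rewrite oppr_eq0 /= addr0 => /eqP H.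
rewrite -[X in _ == X]H.
by apply/eqP; congr (_ + _); apply: eq_bigr => m _; rewrite (g_sym m k Vx).
Qed.

Lemma curvature_mxC i j x : curvature_mx j i x = - curvature_mx i j x.
Proof.
apply/matrixP => k l; rewrite !mxE /curvature_coef.
rewrite opprD opprB -sumrN; congr (_ + _).
by apply: eq_bigr => m _; rewrite opprB.
Qed.

Lemma first_bianchi i j k l x : V x ->
  curvature_mx i j x k l + curvature_mx j k x i l + curvature_mx k i x j l = 0.
Proof.
move=> Vx.
pose P a b c := pderiv a (fun y => christoffel g y l b c) x.
pose S a b c := \sum_m christoffel g x l a m * christoffel g x m b c.
have E a b c : curvature_mx a b x c l = P a b c - P b a c + (S a b c - S b a c).
  by rewrite mxE /curvature_coef sumrB.
have PC a b c : P a b c = P a c b.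
  by rewrite /P; apply: (eq_pderiv openV a Vx) => y; rewrite inE; exact: christoffelC.
have SC a b c : S a b c = S a c b.
  by rewrite /S; apply: eq_bigr => m _; rewrite (christoffelC m b c Vx).
rewrite !E (PC i k j) (PC j i k) (PC k j i) (SC i k j) (SC j i k) (SC k j i).
clearbody P S; ring.
Qed.

(** * Algebraic curvature tensors are determined by their sectional values *)

Lemma skew_of_quad (S : 'M[R]_n) :
  (forall u : 'rV[R]_n, (u *m S *m u^T) 0 0 = 0) -> S^T = - S.
Proof.
move=> S0; apply/matrixP => i j; rewrite !mxE; apply/eqP; rewrite -addr_eq0; apply/eqP.
have B k l : (delta_mx 0 k *m S *m (delta_mx 0 l)^T) (0 : 'I_1) (0 : 'I_1) = S k l.
  by rewrite -rowE trmx_delta -colE !mxE.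
have := S0 (delta_mx 0 i + delta_mx 0 j).
rewrite linearD /= !mulmxDl !mulmxDr mxE [X in X + _]mxE [X in _ + X]mxE.
by rewrite !S0 add0r addr0 !B addrC.
Qed.

Lemma inner_sum (G : 'M[R]_n) u v :
  inner G u v = \sum_i \sum_j u 0 i * v 0 j * G i j.
Proof.
rewrite /inner mxE exchange_big; apply: eq_bigr => j _; rewrite !mxE mulr_suml.
by apply: eq_bigr => i _; rewrite mulrAC.
Qed.

(** The value of the 4-tensor [M] at [(u, v, v, u)]; for the lowered curvature tensor this is the
    numerator of the sectional curvature. *)
Definition biquadratic (M : 'I_n -> 'I_n -> 'M[R]_n) (u v : 'rV[R]_n) :=
  \sum_i \sum_l u 0 i * u 0 l * (\sum_j \sum_k v 0 j * v 0 k * M i j k l).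

Section AlgebraicCurvature.
Variable D : 'I_n -> 'I_n -> 'M[R]_n.
Hypothesis D_skew : forall i j, (D i j)^T = - D i j.
Hypothesis D_C : forall i j, D j i = - D i j.
Hypothesis D_bianchi : forall i j k l, D i j k l + D j k i l + D k i j l = 0.

(** The classical combination of four Bianchi identities with the two skew symmetries. *)
Lemma pair_symmetry i j k l : D i j k l = D k l i j.
Proof.
have s a b c d : D a b d c = - D a b c d.
  by have /matrixP/(_ c d) := D_skew a b; rewrite !mxE.
have c a b d e : D b a d e = - D a b d e by rewrite D_C mxE.
have := D_bianchi i j k l; have := D_bianchi j k l i.
have := D_bianchi k l i j; have := D_bianchi l i j k.
have := (s i j k l, s j k i l, s k l i j, s l i j k, s l j i k, s i k j l).
move=> [[[[[+ +] +] +] +] +]; have := (c i k j l, c l j i k); move=> [+ +].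
lra.
Qed.

(** Polarization in [u] kills the form [S v], which is symmetric by pair symmetry. Polarization in
    [v] then makes [D] skew in its two middle indices, so the three Bianchi terms are equal and
    [3 D = 0]. *)
Lemma algebraic_curvature_eq0 : (forall u v, biquadratic D u v = 0) ->
  forall i j, D i j = 0.
Proof.
move=> bq0 i j.
have c a b d e : D b a d e = - D a b d e by rewrite D_C mxE.
pose S (v : 'rV[R]_n) : 'M[R]_n := \matrix_(i, l) \sum_j \sum_k v 0 j * v 0 k * D i j k l.
have S0 v : S v = 0.
  have Ss : (S v)^T = S v.
    apply/matrixP => a b; rewrite !mxE exchange_big; apply: eq_bigr => p _.
    apply: eq_bigr => q _; rewrite [v 0 q * _]mulrC; congr (_ * _).
    rewrite pair_symmetry c; have /matrixP/(_ q b) := D_skew a p.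
    by rewrite !mxE => ->; rewrite opprK.
  have : (S v)^T = - S v.
    apply: skew_of_quad => u; rewrite -/(inner (S v) u u) inner_sum -[RHS](bq0 u v).
    by apply: eq_bigr => a _; apply: eq_bigr => b _; rewrite mxE.
  rewrite Ss => /eqP; rewrite -addr_eq0 -mulr2n -scaler_nat scaler_eq0 pnatr_eq0 /=.
  by move/eqP.
have T a b p q : D a p q b = - D a q p b.
  pose M : 'M[R]_n := \matrix_(j, k) D a j k b.
  have : M^T = - M.
    apply: skew_of_quad => u; rewrite -/(inner M u u) inner_sum.
    have /matrixP/(_ a b) := S0 u; rewrite [LHS]mxE [RHS]mxE => H.
    rewrite -[RHS]H.
    by apply: eq_bigr => j' _; apply: eq_bigr => k' _; rewrite mxE.
  by move=> /matrixP/(_ q p); rewrite !mxE.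
apply/matrixP => k l; rewrite [RHS]mxE.
have := D_bianchi i j k l; rewrite (T j l k i) (c i j) (c i k) (T i l k j); lra.
Qed.

End AlgebraicCurvature.

(** * The curvature tensor at a point of constant sectional curvature *)

Section ConstantCurvature.
Variables (x : 'rV[R]_n) (K : R).
Hypothesis Vx : V x.
Hypothesis K0 : K != 0.
Hypothesis sec : forall u v : 'rV[R]_n, row_free (col_mx u v) ->
  sectional_curvature g x u v = K.

(** The lowered curvature tensor minus the model tensor of constant curvature [K]; the aim is to
    show that it vanishes. *)
Let D i j : 'M[R]_n :=
  curvature_mx i j x *m g x - K *: (g x *m so_mx R j i *m g x).

Let D_skew i j : (D i j)^T = - D i j.
Proof.
rewrite /D linearB /= curvature_skew // linearZ /= !trmx_mul sym_g // tr_so_mx.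
by rewrite mulNmx mulmxN scalerN opprB opprK addrC !mulmxA.
Qed.

Let D_C i j : D j i = - D i j.
Proof.
rewrite /D curvature_mxC (so_mxC R j i) mulmxN !mulNmx scalerN opprB opprK addrC.
by [].
Qed.

Lemma g_so_g i j k l : (g x *m so_mx R j i *m g x) k l =
  g x k j * g x i l - g x k i * g x j l.
Proof.
have L a b : (g x *m delta_mx a b *m g x) k l = g x k a * g x b l.
  rewrite mxE (bigD1 b) //= !mxE (bigD1 a) //= mxE !eqxx mulr1.
  rewrite !big1 ?addr0 // => [p pb|p pa]; last by rewrite mxE (negPf pa) mulr0.
  rewrite mxE big1 ?mul0r // => q _; by rewrite mxE (negPf pb) andbF mulr0.
by rewrite /so_mx mulmxBr mulmxBl [LHS]mxE [X in _ + X]mxE !L.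
Qed.

Let D_bianchi i j k l : D i j k l + D j k i l + D k i j l = 0.
Proof.
pose C a b c := \sum_m curvature_mx a b x c m * g x m l.
have E a b c : D a b c l = C a b c - K * (g x c b * g x a l - g x c a * g x b l).
  by rewrite -g_so_g [LHS]mxE [X in X + _]mxE [X in _ + X]mxE [X in - X]mxE.
have CB : C i j k + C j k i + C k i j = 0.
  rewrite /C -!big_split big1 // => m _.
  by rewrite /= -!mulrDl (first_bianchi i j k m Vx) mul0r.
apply: etrans (congr2 +%R (congr2 +%R (E i j k) (E j k i)) (E k i j)) _.
rewrite (g_sym k j Vx) (g_sym i k Vx) (g_sym j i Vx).
clearbody C; move: (g x) CB => G; lra.
Qed.

Let bq_curvature u v :
  inner (g x) (curvature g x u v v) u =
  biquadratic (fun i j => curvature_mx i j x *m g x) u v.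
Proof.
have -> : curvature g x u v v = \sum_i \sum_j \sum_k
    (u 0 i * v 0 j * v 0 k) *: row k (curvature_mx i j x).
  apply/rowP => l; rewrite mxE summxE; apply: eq_bigr => i _.
  rewrite summxE; apply: eq_bigr => j _; rewrite summxE; apply: eq_bigr => k _.
  by rewrite !mxE.
rewrite /inner !mulmx_suml summxE; apply: eq_bigr => i _.
rewrite !mulmx_suml summxE; under [RHS]eq_bigr do rewrite mulr_sumr.
rewrite exchange_big; apply: eq_bigr => j _.
rewrite !mulmx_suml summxE; under [RHS]eq_bigr do rewrite mulr_sumr.
rewrite exchange_big; apply: eq_bigr => k _ /=.
rewrite -!scalemxAl -row_mul !mxE mulr_sumr; apply: eq_bigr => l _.
by rewrite [row _ _ _ _]mxE [u^T _ _]mxE; ring.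
Qed.

Let bq_metric u v :
  inner (g x) u u * inner (g x) v v - inner (g x) u v ^+ 2 =
  biquadratic (fun i j => g x *m so_mx R j i *m g x) u v.
Proof.
have P (a b : 'I_n -> 'I_n -> R) :
  \sum_i \sum_k a i k * (\sum_l \sum_j b l j) =
  \sum_i \sum_l \sum_j \sum_k a i k * b l j.
  apply: eq_bigr => i _; rewrite -mulr_suml mulr_sumr; apply: eq_bigr => l _.
  rewrite mulr_sumr; apply: eq_bigr => j _; exact: mulr_suml.
rewrite expr2 [X in _ * X - _]inner_sum [X in _ - _ * X]inner_sum.
have -> : inner (g x) u u * (\sum_i \sum_j v 0 i * v 0 j * g x i j) =
  \sum_i \sum_l \sum_j \sum_k u 0 i * u 0 l * (v 0 j * v 0 k * g x k j) * g x i l.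
  rewrite inner_sum mulr_suml; apply: eq_bigr => i _.
  rewrite mulr_suml; apply: eq_bigr => l _.
  rewrite mulr_sumr; apply: eq_bigr => j _.
  by rewrite mulr_sumr; apply: eq_bigr => k _; rewrite (g_sym k j) //; ring.
have -> : inner (g x) u v * (\sum_i \sum_j u 0 i * v 0 j * g x i j) =
  \sum_i \sum_l \sum_j \sum_k u 0 i * v 0 k * g x i k * (u 0 l * v 0 j * g x l j).
  rewrite -P inner_sum mulr_suml; apply: eq_bigr => i _.
  by rewrite mulr_suml.
rewrite -sumrB; apply: eq_bigr => i _; rewrite -sumrB; apply: eq_bigr => l _.
rewrite -sumrB mulr_sumr; apply: eq_bigr => j _.
rewrite -sumrB mulr_sumr; apply: eq_bigr => k _.
by rewrite g_so_g (g_sym k i) // (g_sym j l) //; ring.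
Qed.

Lemma dependent_rows (u v : 'rV[R]_n) :
  ~~ row_free (col_mx u v) -> u = 0 \/ exists a, v = a *: u.
Proof.
have [->|u0] := eqVneq u 0; first by left.
move=> /negP nf; right; apply: contrapT => /forallNP nv; apply: nf.
apply: inj_row_free => w; rewrite -[w]hsubmxK mul_row_col.
rewrite (mx11_scalar (lsubmx w)) (mx11_scalar (rsubmx w)) !mul_scalar_mx.
set a := lsubmx w 0 0; set b := rsubmx w 0 0 => ab0.
have b0 : b = 0.
  apply/eqP/negPn/negP => b0; apply: (nv (- (b^-1 * a))).
  apply: (scalerI b0); rewrite scalerA mulrN mulrA divff // mul1r scaleNr.
  by apply/eqP; rewrite -addr_eq0 addrC ab0.
move: ab0; rewrite b0 scale0r addr0 => /eqP; rewrite scaler_eq0 (negPf u0) orbF.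
by move=> /eqP ->; rewrite raddf0 row_mx0.
Qed.

Let bq_D u v : biquadratic D u v = 0.
Proof.
have [uv|] := boolP (row_free (col_mx u v)); last first.
  move=> /dependent_rows[->|[a ->]].
    by rewrite /biquadratic big1 // => i _; rewrite big1 // => l _; rewrite mxE !mul0r.
  (* For [v = a *: u] the coefficients are symmetric in [i] and [j], whereas [D] is skew in them. *)
  pose F i j := \sum_l \sum_k u 0 i * u 0 l * (a * u 0 j * (a * u 0 k)) * D i j k l.
  have QF : biquadratic D u (a *: u) = \sum_i \sum_j F i j.
    apply: eq_bigr => i _; rewrite exchange_big; apply: eq_bigr => l _ /=.
    rewrite mulr_sumr; apply: eq_bigr => j _; rewrite mulr_sumr.
    by apply: eq_bigr => k _; rewrite !mxE mulrA.
  have : biquadratic D u (a *: u) = - biquadratic D u (a *: u).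
    rewrite {1}QF exchange_big QF -sumrN; apply: eq_bigr => i _.
    rewrite -sumrN; apply: eq_bigr => j _; rewrite -sumrN; apply: eq_bigr => l _.
    by rewrite -sumrN; apply: eq_bigr => k _; rewrite D_C mxE; ring.
  by move=> /eqP; rewrite -addr_eq0 -mulr2n mulrn_eq0 /= => /eqP.
have := sec uv; rewrite /sectional_curvature bq_curvature bq_metric.
set N := biquadratic _ _ _; set M := biquadratic _ _ _ => e.
(* [K != 0] excludes the junk value [N / 0 = 0]. *)
have M0 : M != 0 by apply: contraNneq K0 => M0; rewrite -e M0 invr0 mulr0.
have {e} NE : N = K * M by rewrite -e divfK.
have -> : biquadratic D u v = N - K * M.
  rewrite /N /M /biquadratic mulr_sumr -sumrB; apply: eq_bigr => i _.
  rewrite mulr_sumr -sumrB; apply: eq_bigr => l _.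
  rewrite mulrCA -mulrBr; congr (_ * _); rewrite mulr_sumr -sumrB; apply: eq_bigr => j _.
  rewrite mulr_sumr -sumrB; apply: eq_bigr => k _.
  rewrite mulrCA -mulrBr; congr (_ * _).
  by rewrite /D [LHS]mxE [X in _ + X]mxE [X in _ - X]mxE.
by rewrite NE subrr.
Qed.

Lemma constant_curvature_mx i j :
  curvature_mx i j x = K *: (g x *m so_mx R j i).
Proof.
apply: (can_inj (mulmxK (unit_g Vx))); apply/eqP; rewrite -subr_eq0 -scalemxAl.
by apply/eqP; exact: (algebraic_curvature_eq0 D_skew D_C D_bianchi bq_D).
Qed.
End ConstantCurvature.


(** * Commuting adjacent covariant derivatives inside an iterated derivative *)

Section PrefixRelation.
Variable K : R.
Hypothesis curvK : forall y i j, V y ->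
  curvature_mx i j y = K *: (g y *m so_mx R j i).

Let C i j y : 'M[R]_n := K *: (g y *m so_mx R j i).

Let smooth_C i j k l : smooth_on V (fun y => C i j y k l).
Proof.
apply: (eq_smooth openV) (_ : smooth_on V
  (fun y => K * \sum_m g y k m * so_mx R j i m l)) => [y _|].
  by rewrite /C [RHS]mxE [in RHS]mxE.
apply: (@smoothM _ _ _ openV (fun=> K)); first exact: (smooth_cst openV).
apply: (smooth_sum openV) => m.
by apply: (smoothM openV); [exact: smooth_g | exact: (smooth_cst openV)].
Qed.

(** This says that the covariant derivative of the curvature vanishes: the correction terms belong
    to [i], to [j] and to the endomorphism. It follows from [metric_parallel], since [C] is the
    metric times constant matrices. *)
Lemma curvature_parallel k i j x : V x ->
  pderiv_mx k (C i j) x =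
  \sum_l connection k x i l *: C l j x + \sum_l connection k x j l *: C i l x
  + (connection k x *m C i j x - C i j x *m connection k x).
Proof.
move=> Vx; set X := connection k x.
have -> : pderiv_mx k (C i j) x = K *: (pderiv_mx k g x *m so_mx R j i).
  apply/matrixP => a b; rewrite [LHS]mxE [RHS]mxE [in RHS]mxE.
  have sgS m : smooth_on V (fun y => g y a m * so_mx R j i m b).
    by apply: (smoothM openV); [exact: smooth_g | exact: (smooth_cst openV)].
  have -> : (fun y => C i j y a b) = (fun y => K * \sum_m g y a m * so_mx R j i m b).
    by apply/funext => y; rewrite /C [LHS]mxE [in LHS]mxE.
  rewrite (pderivM k (smooth_cst openV K) (smooth_sum openV _ _ sgS) Vx).
  rewrite pderiv_cst mul0r add0r; congr (_ * _).
  rewrite (pderiv_sum k sgS Vx); apply: eq_bigr => m _.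
  rewrite (pderivM k (smooth_g a m) (smooth_cst openV _) Vx) pderiv_cst mulr0 addr0.
  by rewrite [in RHS]mxE.
rewrite metric_parallel // -/X mulmxDl.
have H : X^T *m so_mx R j i = \sum_q X j q *: so_mx R q i +
    \sum_q X i q *: so_mx R j q - so_mx R j i *m X.
  by rewrite -so_mx_derivation addrK.
have S1 : \sum_l X i l *: C l j x = K *: (g x *m \sum_q X i q *: so_mx R j q).
  rewrite mulmx_sumr scaler_sumr; apply: eq_bigr => l _.
  by rewrite -scalemxAr scalerA mulrC -scalerA.
have S2 : \sum_l X j l *: C i l x = K *: (g x *m \sum_q X j q *: so_mx R q i).
  rewrite mulmx_sumr scaler_sumr; apply: eq_bigr => l _.
  by rewrite -scalemxAr scalerA mulrC -scalerA.
rewrite S1 S2 /C -scalemxAr -scalemxAl -scalerBr -!scalerDr mulmxA; congr (K *: _).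
rewrite -[g x *m X^T *m _]mulmxA H -[g x *m _ *m X]mulmxA !(mulmxDr (g x)).
by rewrite mulmxN addrCA [X in X + _ = _]addrC.
Qed.

(** The Ricci identity behind a prefix of [p] slots. New slots are added in front, so [a] stems from
    derivatives taken after the interchange, and the curvature acts on [J] alone. *)
Definition commutation p A B := forall a i j J y, V y -> size a = p ->
  B (a ++ i :: j :: J) y - B (a ++ j :: i :: J) y =
  - act (C i j y) (fun u => A (a ++ u) y) J.

(** The relation is differentiated covariantly. Because the curvature is parallel, the derivative of
    [C] cancels the connection terms in the slots [i], [j] and in the endomorphism indices. *)
Lemma commutation_step p A B : smooth_tensor A -> smooth_tensor B ->
  commutation p A B -> commutation p.+1 (cov_deriv g A) (cov_deriv g B).
Proof.
move=> sA sB cAB [//|k a] i j J x Vx [sa].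
pose X := connection k x.
have sAa : smooth_tensor (fun u => A (a ++ u)) by move=> u; apply: sA.
pose dC := act (pderiv_mx k (C i j) x) (fun u => A (a ++ u) x) J.
pose CdA := act (C i j x) (fun u => pderiv k (A (a ++ u)) x) J.
pose Ca := act (C i j x) (fun v => act X (fun u => A (u ++ v) x) a) J.
pose G1 := \sum_l X i l * act (C l j x) (fun u => A (a ++ u) x) J.
pose G2 := \sum_l X j l * act (C i l x) (fun u => A (a ++ u) x) J.
pose GC := act X (act (C i j x) (fun u => A (a ++ u) x)) J.
pose CG := act (C i j x) (act X (fun u => A (a ++ u) x)) J.
have -> : act (C i j x) (fun u => cov_deriv g A ((k :: a) ++ u) x) J =
    CdA - (Ca + CG).
  rewrite /Ca /CG -actD /CdA -actB; apply: eq_act => u _.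
  by rewrite cat_cons cov_derivE act_cat.
have P : pderiv k (B (a ++ i :: j :: J)) x - pderiv k (B (a ++ j :: i :: J)) x =
    - (dC + CdA).
  rewrite -(pderivB k (sB _) (sB _) Vx).
  rewrite /dC /CdA -(pderiv_act k J (smooth_C i j) sAa Vx).
  rewrite -(pderivN k (smooth_act J (smooth_C i j) sAa) Vx).
  by apply: (eq_pderiv openV k Vx) => y; rewrite inE => Vy; apply: cAB.
(* The connection corrections of [B], sorted by the slot they hit: the prefix [a], the slot of [i],
   the slot of [j], and [J]. *)
have E : act X (B^~ x) (a ++ i :: j :: J) - act X (B^~ x) (a ++ j :: i :: J) =
    - Ca - G1 - G2 - GC.
  have -> : - Ca = act X (fun u => B (u ++ i :: j :: J) x - B (u ++ j :: i :: J) x) a.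
    rewrite /Ca -act_act -actN; apply: eq_act => u us.
    by rewrite cAB // us.
  have -> : G1 = - \sum_l X i l * (B (a ++ l :: j :: J) x - B (a ++ j :: l :: J) x).
    by rewrite -sumrN; apply: eq_bigr => l _; rewrite cAB // mulrN opprK.
  have -> : G2 = - \sum_l X j l * (B (a ++ i :: l :: J) x - B (a ++ l :: i :: J) x).
    by rewrite -sumrN; apply: eq_bigr => l _; rewrite cAB // mulrN opprK.
  have -> : GC = - act X (fun u => B (a ++ i :: j :: u) x - B (a ++ j :: i :: u) x) J.
    by rewrite -actN; apply: eq_act => u _; rewrite cAB // opprK.
  have D (f h : 'I_n -> R) (M : 'I_n -> R) : \sum_l M l * (f l - h l) =
     \sum_l M l * f l - \sum_l M l * h l.
    by rewrite -sumrB; apply: eq_bigr => l _; rewrite mulrBr.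
  rewrite !act_cat /= !actB !D !opprK.
  move: (act X _ a) (act X _ a) (act X _ J) (act X _ J).
  move: (\sum_k _) (\sum_k _) (\sum_k _) (\sum_k _) => *; ring.
have dCE : dC = G1 + G2 + (GC - CG).
  rewrite /dC curvature_parallel // act_mxD -act_comm act_mxD !act_mx_sum.
  by congr (_ + _ + _); apply: eq_bigr => l _; rewrite act_mxZ.
have -> : cov_deriv g B ((k :: a) ++ i :: j :: J) x -
    cov_deriv g B ((k :: a) ++ j :: i :: J) x =
    (pderiv k (B (a ++ i :: j :: J)) x - pderiv k (B (a ++ j :: i :: J)) x) -
    (act X (B^~ x) (a ++ i :: j :: J) - act X (B^~ x) (a ++ j :: i :: J)).
  rewrite !cat_cons !cov_derivE.
  by move: (pderiv _ _ _) (pderiv _ _ _) (act _ _ _) (act _ _ _) => *; ring.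
rewrite P E dCE; clearbody dC CdA Ca G1 G2 GC CG; ring.
Qed.

Lemma commutation_iter p A : smooth_tensor A ->
  commutation p (iter p (cov_deriv g) A) (iter p.+2 (cov_deriv g) A).
Proof.
move=> sA; elim: p => [|p IH].
  move=> [|//] i j J y Vy _; rewrite [LHS](ricci_identity i j J sA Vy).
  by rewrite curvK.
by apply: commutation_step IH; exact: smooth_iter_cov_deriv.
Qed.

(** Taking the length of the list as the order of differentiation collects all iterated derivatives
    in one function [F], so both sides of the relation are values of [F]. *)
Lemma iter_cov_deriv_swap (h : 'rV[R]_n -> R) a i j b x : smooth_on V h -> V x ->
  let F s := iter_cov_deriv g (size s) h s x in
  F (a ++ i :: j :: b) - F (a ++ j :: i :: b) =
  - act (C i j x) (fun u => F (a ++ u)) b.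
Proof.
move=> sh Vx F.
have sA : smooth_tensor (iter (size b) (cov_deriv g) (fun=> h)).
  by apply: smooth_iter_cov_deriv => J.
rewrite (@eq_act _ _ _ _ (fun u => iter (size a) (cov_deriv g)
    (iter (size b) (cov_deriv g) (fun=> h)) (a ++ u) x)).
  rewrite -(@commutation_iter (size a) _ sA a i j b x Vx (erefl _)).
  by rewrite /F /iter_cov_deriv !size_cat /= !addnS -!iterS -!iterD.
by move=> u ub; rewrite /F /iter_cov_deriv size_cat ub iterD.
Qed.

Lemma frame_swap (h : 'rV[R]_n -> R) (E : 'M[R]_n) x : smooth_on V h -> V x ->
  orthonormal_frame (g x) E ->
  let F := ev E (fun s => iter_cov_deriv g (size s) h s x) in
  forall a i j b, F (a ++ i :: j :: b) - F (a ++ j :: i :: b) =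
  K * act (so_mx R i j) (fun u => F (a ++ u)) b.
Proof.
move=> sh Vx oE F a i j b.
pose f s := iter_cov_deriv g (size s) h s x.
pose f' v := ev E (fun u => f (u ++ v)) a.
(* Minus the curvature endomorphism in the frame directions [i] and [j], written in coordinates.
   Orthonormality of [E] identifies it in the frame with [K *: so_mx i j]. *)
pose Y := \sum_k \sum_l (E i k * E j l) *: - C k l x.
have YE : (K *: so_mx R i j) *m E = E *m Y.
  have -> : Y = - K *: (g x *m (E^T *m so_mx R j i *m E)).
    have N c d : E^T *m delta_mx c d *m E =
        \sum_l \sum_k (E d k * E c l) *: delta_mx l k.
      rewrite mulmx_delta_sum mulmx_suml; apply: eq_bigr => l _.
      rewrite -scalemxAl mul_delta_mx_sum scaler_sumr; apply: eq_bigr => k _.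
      by rewrite scalerA mxE mulrC.
    rewrite /so_mx mulmxBr mulmxBl !N exchange_big -sumrB mulmx_sumr scaler_sumr.
    apply: eq_bigr => k _; rewrite -sumrB mulmx_sumr scaler_sumr.
    apply: eq_bigr => l _; rewrite [E j l * E i k]mulrC -scalerBr -scalemxAr.
    by rewrite scalerA scalerN scalerA -scaleNr mulNr mulrC.
  rewrite -scalemxAr !mulmxA oE mul1mx (so_mxC R i j) mulNmx -scalemxAl.
  by rewrite scalerN scaleNr opprK.
have -> : K * act (so_mx R i j) (fun u => F (a ++ u)) b = ev E (act Y f') b.
  rewrite -act_mxZ -(act_ev _ _ YE); apply: eq_act => u _.
  by rewrite /F ev_cat -ev_ev.
have -> : ev E (act Y f') b = ev E (fun u => ev E (act Y (fun v => f (u ++ v))) b) a.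
  rewrite -ev_ev; apply: eq_ev => v _.
  exact: (act_ev_comm Y E (fun u v => f (u ++ v))).
rewrite /F !ev_cat -evB; apply: eq_ev => u _ /=.
have -> : \sum_k E j k * (\sum_l E i l * ev E (fun v => f (u ++ [:: k, l & v])) b) =
   \sum_k \sum_l E i k * E j l * ev E (fun v => f (u ++ [:: l, k & v])) b.
  rewrite exchange_big; apply: eq_bigr => k _; rewrite mulr_sumr.
  by apply: eq_bigr => l _; rewrite mulrCA mulrA.
transitivity (\sum_k \sum_l E i k * E j l *
    ev E (fun v => f (u ++ [:: k, l & v]) - f (u ++ [:: l, k & v])) b).
  rewrite -sumrB; apply: eq_bigr => k _; rewrite mulr_sumr -sumrB.
  by apply: eq_bigr => l _; rewrite mulrA -mulrBr -evB.
transitivity (ev E (fun v => \sum_k \sum_l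
    E i k * E j l * - act (C k l x) (fun v => f (u ++ v)) v) b).
  rewrite ev_sum; apply: eq_bigr => k _; rewrite ev_sum; apply: eq_bigr => l _.
  by rewrite evZ; congr (_ * _); apply: eq_ev => v _; exact: iter_cov_deriv_swap.
apply: eq_ev => v _; rewrite act_mx_sum; apply: eq_bigr => k _.
by rewrite act_mx_sum; apply: eq_bigr => l _; rewrite [RHS]act_mxZ act_mxN.
Qed.

(** Applies [sumseq_reversal] to the word tensor and the frame components of the iterated
    derivatives; reindexing then moves the reversal from the derivatives to the word. *)
Lemma word_deriv_rev (T : choiceType) (w : seq T) (h : 'rV[R]_n -> R) (E : 'M[R]_n) x :
  is_word w -> smooth_on V h -> V x -> orthonormal_frame (g x) E ->
  word_deriv g (rev w) E x h = word_deriv g w E x h.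
Proof.
move=> ww sh Vx oE.
pose F := ev E (fun s => iter_cov_deriv g (size s) h s x).
have WE (v : seq T) : word_deriv g v E x h =
    sumseq (size v) (fun s => (compatible v s)%:R * F s).
  rewrite word_derivE; apply: eq_sumseq => s ss; congr (_ * _).
  by apply: eq_ev => u us; rewrite us ss.
rewrite !WE size_rev (sumseq_reversal (frame_swap sh Vx oE) (word_so_invariant ww)).
rewrite -[LHS]sumseq_rev; apply: eq_sumseq => s ss.
by rewrite compatible_rev.
Qed.

End PrefixRelation.
End LocalGeometry.

(** * From a coordinate domain to the manifold and the word polynomials *)

Lemma sub_smooth_on (R : realType) (n : nat) (U V : set 'rV[R]_n) h :
  U `<=` V -> smooth_on V h -> smooth_on U h.
Proof. by move=> UV sh s x /UV; apply: sh. Qed.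

Lemma pos_unitmx (R : realType) (n : nat) (G : 'M[R]_n) :
  (forall v : 'rV[R]_n, v != 0 -> 0 < inner G v v) -> G \in unitmx.
Proof.
move=> G0; rewrite -row_free_unit; apply: inj_row_free => v vG.
apply/eqP/negPn/negP => /G0; by rewrite /inner vG mul0mx mxE ltxx.
Qed.

Lemma open_coord (R : realType) (n : nat) (M : topologicalType) (c : chart R n M)
  (W : set M) : is_chart c -> open W -> open (Defs.coord c @` (cdom c `&` W)).
Proof.
move=> [_ oc pK _ cp] oW; rewrite openE => _ [q [cq Wq] <-].
rewrite continuous_open_subspace // in cp.
have cq' : ccod c (Defs.coord c q) by exists q.
have nW : nbhs (Defs.coord c q) (param c @^-1` W).
  by apply: (cp (Defs.coord c q)); rewrite ?inE // pK //; apply: open_nbhs_nbhs.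
have nc : nbhs (Defs.coord c q) (ccod c) by apply: open_nbhs_nbhs.
apply: filterS (filterI nc nW) => y [[r cr <-]] /=.
by rewrite pK // => Wr; exists r.
Qed.

Lemma is_word_rev (T : eqType) (w : seq T) : is_word w -> is_word (rev w).
Proof. by move=> ww c; rewrite mem_rev count_rev; apply: ww. Qed.

(** The local reversal identity is applied to the real and imaginary parts of [f] on the coordinate
    image [V] of the part of the chart domain inside [W]. *)
Lemma is_word_poly_rev (R : realType) (n : nat) (K : R) (T : choiceType)
  (w : seq T) (P : {poly R[i]}) : K != 0 -> is_word w ->
  is_word_poly n K w P -> is_word_poly n K (rev w) P.
Proof.
move=> K0 ww wP M cM compM KM W lambda f oW sf lf c p E ac cp Wp oE.
rewrite -(wP M cM compM KM W lambda f oW sf lf c p E ac cp Wp oE).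
pose V := Defs.coord c @` (cdom c `&` W).
have oV : open V by apply: open_coord => //; apply: atlas_chart.
have Vc : V `<=` ccod c by move=> _ [q [cq _] <-]; exists q.
have sg i j : smooth_on V (fun x => metric c x i j).
  exact: sub_smooth_on Vc (Defs.metric_smooth ac i j).
have symg y : V y -> (metric c y)^T = metric c y.
  by move=> /Vc cy; exact: Defs.metric_sym ac cy.
have unitg y : V y -> metric c y \in unitmx.
  by move=> /Vc cy; apply: pos_unitmx; exact: Defs.metric_pos ac cy.
have curvK y i j : V y -> curvature_mx (metric c) i j y =
    K *: (metric c y *m so_mx R j i).
  move=> Vy; apply: (constant_curvature_mx oV) => //.
  by case: Vy => q [cq _] <-; apply: KM.
have Vp : V (Defs.coord c p) by exists p.
have [sre sim] := sf c ac.
rewrite /complexify (word_deriv_rev oV sg symg unitg curvK ww sre Vp oE).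
by rewrite (word_deriv_rev oV sg symg unitg curvK ww sim Vp oE).
Qed.

Theorem proposition5p6 (R : realType) (n : nat) (K : R) (T : choiceType)
    (w : seq T) (hn : (2 <= n)%N) (hK : K != 0) (hw : is_word w) :
  word_poly n K w = word_poly n K (rev w).
Proof.
(* Both polynomials are chosen by [xget] from sets that turn out to be equal; the second inclusion
   is the first one for the reversed word. *)
congr (xget 0 _); apply/seteqP; split=> P /=; first exact: is_word_poly_rev.
by rewrite -{2}[w]revK; apply: is_word_poly_rev => //; apply: is_word_rev.
Qed.
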